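(* Let $d\ge1$, let $\Omega\subset\mathbb{R}^d$ be an open bounded hyperrectangle, let $\alpha>0$ and $f\in L^2(\Omega)$, and let $u_f$ be the unique minimizer over $u\in L^2(\Omega)$ of $\frac12\|u-f\|_{L^2(\Omega)}^2+\alpha J(u)$, where $J$ is the $\ell^1$-anisotropic total variation. Then $$\int_\Omega\varphi(u_f(x))\,dx\le\int_\Omega\varphi(u(x))\,dx$$ for every $u\in f-\alpha\,\partial J(0)$ and every convex function $\varphi:\mathbb{R}\to\mathbb{R}$.
   Context: $\Omega=a+\prod_{i=1}^d(0,l_i)$ with $a\in\mathbb{R}^d$, $l\in\mathbb{R}^d_{>0}$. $J:L^2(\Omega)\to[0,+\infty]$ is the $\ell^1$-anisotropic total variation $$J(u)=\sup\Big\{\int_\Omega u\,\mathrm{div}\,H\,dx : H\in C_c^\infty(\Omega,\mathbb{R}^d),\ |H(x)|_\infty\le 1\ \text{for all }x\in\Omega\Big\},$$ where $|\cdot|_\infty$ is the maximum norm. $J$ is proper, convex and lower semicontinuous, so $u_f$ exists and is unique. $\partial J(0)=\{p\in L^2(\Omega):\int_\Omega p\,v\,dx\le J(v)\text{ for all }v\in L^2(\Omega)\}$ is the subdifferential of $J$ at $0$ in $L^2(\Omega)$. The integrals in the claim take values in $(-\infty,+\infty]$. *)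

(* Defs.v *)
From HB Require Import structures.
From mathcomp Require Import all_boot all_order all_algebra.
From mathcomp Require Import all_classical all_reals all_analysis.

Set Implicit Arguments.
Unset Strict Implicit.
Unset Printing Implicit Defensive.

Import Order.TTheory GRing.Theory Num.Theory.
Import numFieldNormedType.Exports.

Local Open Scope classical_set_scope.
Local Open Scope ring_scope.

(* The product sigma-algebra on R^n, i.e. the one generated by the coordinate
   maps; it is defined as the library does for [n.-tuple T]. *)
Definition rV_coord (R : realType) (n : nat) (i : 'I_n) (x : 'rV[R]_n) :
  measurableTypeR R := x 0 i.

Definition measure_rV_display : measure_display.
Proof. by constructor. Qed.

Section measurable_rV.
Context (R : realType) (n : nat).

Let rV_set0 : g_sigma_preimage (@rV_coord R n) set0.
Proof. exact: sigma_algebra0. Qed.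

Let rV_setC A :
  g_sigma_preimage (@rV_coord R n) A -> g_sigma_preimage (@rV_coord R n) (~` A).
Proof. exact: sigma_algebraC. Qed.

Let rV_bigcup (F : (set 'rV[R]_n)^nat) :
  (forall i, g_sigma_preimage (@rV_coord R n) (F i)) ->
  g_sigma_preimage (@rV_coord R n) (\bigcup_i (F i)).
Proof. exact: sigma_algebra_bigcup. Qed.

HB.instance Definition _ := @isMeasurable.Build measure_rV_display
  'rV[R]_n (g_sigma_preimage (@rV_coord R n)) rV_set0 rV_setC rV_bigcup.

End measurable_rV.

Lemma measurable_rV_coord (R : realType) (n : nat) (i : 'I_n) :
  measurable_fun [set: 'rV[R]_n] (rV_coord i).
Proof.
move=> _ Y mY; rewrite setTI; apply: sub_sigma_algebra => /=.
rewrite -bigcup_seq/=; exists i => /=; first by rewrite mem_index_enum.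
by exists Y => //; rewrite setTI.
Qed.

Lemma measurable_fun_rVP (d : measure_display) (T : measurableType d)
    (R : realType) (n : nat) (f : T -> 'rV[R]_n) :
  (forall i, measurable_fun [set: T] (rV_coord i \o f)) ->
  measurable_fun [set: T] f.
Proof.
move=> mf _ A mA; rewrite setTI; move: A mA.
suff : g_sigma_preimage (fun i => rV_coord i \o f) `<=` measurable.
  rewrite g_sigma_preimage_comp => h A mA; apply: h.
  by exists A => //; rewrite setTI.
apply: smallest_sub; first exact: sigma_algebra_measurable.
move=> B; rewrite -bigcup_seq/= => -[i _ [C mC <-]].
exact: mf.
Qed.

(* The isomorphism R * R^n -> R^(n+1). *)
Definition rV_cons (R : realType) (n : nat)
  (p : measurableTypeR R * 'rV[R]_n) : 'rV[R]_n.+1 :=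
  row_mx (const_mx p.1 : 'rV[R]_1) p.2.

Definition rV_uncons (R : realType) (n : nat) (x : 'rV[R]_n.+1) :
  measurableTypeR R * 'rV[R]_n :=
  (x 0 0, rsubmx (x : 'rV[R]_(1 + n))).

Lemma rV_consK (R : realType) (n : nat) : cancel (@rV_cons R n) (@rV_uncons R n).
Proof.
move=> [x v]; rewrite /rV_uncons /rV_cons row_mxKr; congr pair.
by rewrite mxE; case: splitP => // j _; rewrite mxE.
Qed.

Lemma rV_unconsK (R : realType) (n : nat) :
  cancel (@rV_uncons R n) (@rV_cons R n).
Proof.
move=> x; rewrite -[RHS](@hsubmxK _ 1 1 n).
apply: (congr2 (@row_mx R 1 1 n)) => //.
apply/rowP => i; rewrite !mxE ord1.
by congr (x _ _); exact/val_inj.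
Qed.

Lemma measurable_rV_cons (R : realType) (n : nat) :
  measurable_fun [set: measurableTypeR R * 'rV[R]_n] (@rV_cons R n).
Proof.
apply: measurable_fun_rVP => i.
have [j ->|j ->] := @split_ordP 1 n i.
- rewrite (_ : _ \o _ = fst)//.
  apply/funext => p; apply: etrans (@row_mxEl R 1 1 n _ _ 0 j) _.
  by rewrite mxE.
- rewrite (_ : _ \o _ = rV_coord j \o snd); last first.
    by apply/funext => p; exact: (@row_mxEr R 1 1 n).
  exact: measurableT_comp (measurable_rV_coord j) measurable_snd.
Qed.

Lemma measurable_rV_uncons (R : realType) (n : nat) :
  measurable_fun [set: 'rV[R]_n.+1] (@rV_uncons R n).
Proof.
apply/measurable_fun_pairP; split; first exact: (measurable_rV_coord ord0).
apply: measurable_fun_rVP => i.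
rewrite (_ : _ \o _ = @rV_coord R n.+1 (rshift 1 i)).
  exact: measurable_rV_coord.
by apply/funext => x; rewrite /rV_coord /= mxE.
Qed.

Section lebesgue_rV_succ.
Local Open Scope ereal_scope.
Context (R : realType) (n : nat).
Variable m : {sigma_finite_measure set 'rV[R]_n -> \bar R}.

Definition lebesgue_rV_succ : set 'rV[R]_n.+1 -> \bar R :=
  pushforward (lebesgue_measure \x m) (@rV_cons R n).

Let mu : {measure set 'rV[R]_n.+1 -> \bar R} :=
  measure_function_pushforward__canonical__measure_function_Measure
    (lebesgue_measure \x m) (@measurable_rV_cons R n).

HB.instance Definition _ := Measure.copy lebesgue_rV_succ mu.

Let lebesgue_rV_succ_sigma_finite : sigma_finite setT lebesgue_rV_succ.
Proof.
have /sigma_finiteP[F [TF ndF Foo]] := sigma_finiteT (@lebesgue_measure R).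
have /sigma_finiteP[G [TG ndG Goo]] := sigma_finiteT m.
exists (fun k => @rV_uncons R n @^-1` (F k `*` G k)).
  rewrite -preimage_bigcup -(preimage_setT (@rV_uncons R n)); congr preimage.
  apply/seteqP; split => // -[x y] _.
  have [i _ Fix] : (\bigcup_i F i) x by rewrite -TF.
  have [j _ Gjy] : (\bigcup_i G i) y by rewrite -TG.
  exists (maxn i j) => //; split.
  - by move: x Fix; exact/subsetPset/ndF/leq_maxl.
  - by move: y Gjy; exact/subsetPset/ndG/leq_maxr.
move=> k; have [mF Fkoo] := Foo k; have [mG Gkoo] := Goo k; split.
  rewrite -[X in measurable X]setTI.
  by apply: measurable_rV_uncons => //; exact: measurableX.
rewrite /lebesgue_rV_succ /pushforward -comp_preimage.
rewrite (_ : _ \o _ = id); last by apply/funext => p /=; rewrite rV_consK.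
rewrite [ltLHS]product_measure1E// lte_mul_pinfty//.
by rewrite ge0_fin_numE.
Qed.

HB.instance Definition _ := Measure_isSigmaFinite.Build _ _ _ lebesgue_rV_succ
  lebesgue_rV_succ_sigma_finite.

End lebesgue_rV_succ.

(* Lebesgue measure on the Borel sets of R^n, as an iterated product. *)
Fixpoint lebesgue_rV (R : realType) (n : nat) :
    {sigma_finite_measure set 'rV[R]_n -> \bar R} :=
  match n with
  | 0 => \d_(0 : 'rV[R]_0)
  | n'.+1 => lebesgue_rV_succ (lebesgue_rV R n')
  end.


(* a + \prod_i (0, l_i) *)
Definition hyperrectangle (R : realType) (d : nat) (a l : 'rV[R]_d) :
    set 'rV[R]_d :=
  [set x | forall i, a 0 i < x 0 i < a 0 i + l 0 i].

Lemma lebesgue_rV_hyperrectangle (R : realType) (d : nat) (a l : 'rV[R]_d) :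
  (forall i, 0 <= l 0 i) ->
  lebesgue_rV R d (hyperrectangle a l) = (\prod_(i < d) l 0 i)%:E.
Proof.
elim: d a l => [|d IH] a l l0.
  by rewrite big_ord0 /= diracE mem_set// => -[].
rewrite big_ord_recl /= /lebesgue_rV_succ /pushforward.
rewrite (_ : _ @^-1` _ = `]a 0 0, a 0 0 + l 0 0[%classic `*`
    hyperrectangle (\row_i a 0 (lift ord0 i))
      (\row_i l 0 (lift ord0 i))); last first.
  have c0 x v : @rV_cons R d (x, v) 0 0 = x.
    by have := congr1 fst (rV_consK (x, v)).
  have cS x v i : @rV_cons R d (x, v) 0 (lift ord0 i) = v 0 i.
    by rewrite (_ : lift ord0 i = rshift 1 i) ?[LHS]row_mxEr//; exact/val_inj.
  apply/seteqP; split => [[x v] h|[x v] [/= hx hv]].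
    split; first by have := h ord0; rewrite c0 /= in_itv.
    by move=> i; have := h (lift ord0 i); rewrite cS !mxE.
  move=> i; have [j ->|->] := unliftP ord0 i.
    by have := hv j; rewrite cS !mxE.
  by rewrite c0; move: hx; rewrite in_itv.
have mbox : measurable
    (hyperrectangle (\row_i a 0 (lift ord0 i)) (\row_i l 0 (lift ord0 i))).
  rewrite [X in measurable X](_ : _ = \bigcap_(i in [set: 'I_d])
    (rV_coord i @^-1`
     `]a 0 (lift ord0 i), a 0 (lift ord0 i) + l 0 (lift ord0 i)[%classic));
    last first.
    apply/seteqP; split => x h i; first by move=> _; have := h i; rewrite /= in_itv !mxE.
    by have := h i I; rewrite /= in_itv !mxE.
  apply: fin_bigcap_measurable => // i _.
  by rewrite -[X in measurable X]setTI; exact: measurable_rV_coord.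
rewrite [LHS]product_measure1E//= IH; last by move=> i; rewrite mxE.
rewrite lebesgue_measure_itv/= lte_fin ltrDl.
under eq_bigr do rewrite mxE.
case: ltgtP (l0 0) => [l00 _||<- _]; rewrite ?mul0r ?mul0e//.
by rewrite -EFinD addrAC subrr add0r -EFinM.
Qed.

(* Functions on Omega are represented by functions on R^d whose values outside
   Omega are irrelevant: u \_ Omega is the extension of u by zero. *)
Definition L2 (R : realType) (d : nat) (Omega : set 'rV[R]_d) :
    set ('rV[R]_d -> R) :=
  [set u | u \_ Omega \in Lfun (lebesgue_rV R d) 2%:E].

Definition L2norm (R : realType) (d : nat) (Omega : set 'rV[R]_d)
    (u : 'rV[R]_d -> R) : \bar R :=
  ('N[lebesgue_rV R d]_2%:E [EFin \o (u \_ Omega)])%E.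

Definition partial (R : realType) (d : nat) (i : 'I_d) (f : 'rV[R]_d -> R) :
    'rV[R]_d -> R :=
  'D_(delta_mx 0 i) f.

(* C^oo: all iterated partial derivatives exist and are continuous. *)
Definition smooth (R : realType) (d : nat) (f : 'rV[R]_d -> R) : Prop :=
  forall s : seq 'I_d, let g := foldr (@partial R d) f s in
    continuous g /\ forall i x, derivable g x (delta_mx 0 i).

Definition divergence (R : realType) (d : nat) (H : 'rV[R]_d -> 'rV[R]_d)
    (x : 'rV[R]_d) : R :=
  \sum_(i < d) partial i (fun y => H y 0 i) x.

Definition closed_support (R : realType) (d : nat) (H : 'rV[R]_d -> 'rV[R]_d) :
    set 'rV[R]_d :=
  closure [set x | H x != 0].

(* The fields in C_c^oo(Omega, R^d) with values in the unit ball of the maximum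
   norm, which is the library's norm on 'rV[R]_d; a field in C_c^oo(Omega, R^d)
   is identified with its extension by zero to R^d. *)
Definition test_field (R : realType) (d : nat) (Omega : set 'rV[R]_d) :
    set ('rV[R]_d -> 'rV[R]_d) :=
  [set H : 'rV[R]_d -> 'rV[R]_d | [/\ forall i, smooth (fun x => H x 0 i),
               compact (closed_support H),
               closed_support H `<=` Omega &
               forall x, Omega x -> `|H x| <= 1]].

Section anisotropic_TV.
Local Open Scope ereal_scope.
Context (R : realType) (d : nat) (Omega : set 'rV[R]_d).

Definition anisotropic_TV (u : 'rV[R]_d -> R) : \bar R :=
  ereal_sup [set \int[lebesgue_rV R d]_(x in Omega) (u x * divergence H x)%:E
            | H in test_field Omega].

Definition ROF (f : 'rV[R]_d -> R) (alpha : R) (u : 'rV[R]_d -> R) : \bar R :=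
  (2^-1)%:E * L2norm Omega (u \- f)%R ^+ 2 + alpha%:E * anisotropic_TV u.

Definition ROF_minimizer (f : 'rV[R]_d -> R) (alpha : R) (u : 'rV[R]_d -> R) :
    Prop :=
  L2 Omega u /\ forall v, L2 Omega v -> ROF f alpha u <= ROF f alpha v.

Definition subdiff0 : set ('rV[R]_d -> R) :=
  [set p | L2 Omega p /\ forall v, L2 Omega v ->
    \int[lebesgue_rV R d]_(x in Omega) (p x * v x)%:E <= anisotropic_TV v].

End anisotropic_TV.

(* Main.v *)
(* Let psi be nondecreasing and 1-Lipschitz. The increments of u - psi(u) and of
   psi(u) between two points have the same sign and add up to the increment of
   u. As J(u) is the limit of sum_i int |u(x + h e_i) - u(x)| / h dx, it follows
   that J(u - psi(u)) + J(psi(u)) <= J(u). Comparing u_f with u_f - t psi(u_f)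
   and letting t tend to 0, one obtains int (u - u_f) psi(u_f) >= 0 for every u
   in f - alpha dJ(0). Difference quotients of phi, truncated, are admissible
   psi (up to scaling) and converge to the left derivative s of phi; integrate
   phi(u) >= phi(u_f) + s(u_f) (u - u_f) to conclude, the truncation being
   removed by Fatou's lemma. *)

Require Import Defs.
From HB Require Import structures.
From mathcomp Require Import all_boot all_order all_algebra.
From mathcomp Require Import all_classical all_reals all_analysis.
From mathcomp Require Import measurable_realfun ring lra.

Set Implicit Arguments.
Unset Strict Implicit.
Unset Printing Implicit Defensive.

Import Order.TTheory GRing.Theory Num.Theory.
Import numFieldNormedType.Exports.

Local Open Scope classical_set_scope.
Local Open Scope ring_scope.

(** * Smooth functions of one variable *)

(** The limit formula for J enters as two one-sided facts. For h < delta, the difference quotients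
    of u over the box shrunk by delta are bounded by J(u); for a fixed test field H, the difference
    quotients of v paired with H tend to the integral of v div H. The pointwise splitting of
    increments is inserted between the two. The first fact calls for C^oo fields that nearly attain
    the sign of a difference quotient while staying bounded by 1. Since the constraint is on the
    maximum norm, the components can be chosen independently, and averaging the i-th one along e_i
    alone suffices, provided that the averaged function is already smooth. Finite sums of products
    of one-variable functions serve here in place of convolutions: they have antiderivatives of the
    same kind along e_i, and a box has cutoffs that are products. The truncation acts on the
    argument of the slope: difference quotients of phi are in general Lipschitz only on bounded
    sets, and s(u_f) need not be square integrable. *)

Section smooth1.
Context {R : realType}.
Implicit Types (f g : R -> R) (n : nat).

Lemma is_derive_continuous f (df : R -> R) :
  (forall x : R, is_derive x 1 f (df x)) -> continuous f.
Proof.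
move=> fd x; apply/differentiable_continuous/derivable1_diffP.
by case: (fd x).
Qed.

Lemma mean_value f (df : R -> R) (a b : R) : a <= b ->
  (forall x : R, is_derive x 1 f (df x)) ->
  exists2 c, a <= c <= b & f b - f a = df c * (b - a).
Proof.
move=> ab fd; have [c|c cab fE] := @MVT_segment R f df a b ab (fun x _ => fd x).
  exact/continuous_subspaceT/is_derive_continuous.
by exists c => //; move: cab; rewrite in_itv.
Qed.

(** Differentiability n times, with the derivative as a witness and no continuity asked of the last
    one; quantified over all n this is C^oo. The witness turns the closure properties into
    inductions on n. *)
Fixpoint Ck n f : Prop :=
  if n is m.+1 then
    exists2 g, (forall x : R, is_derive x 1 f (g x)) & Ck m g
  else True.

Definition smooth1 f := forall n, Ck n f.

Lemma Ck_pred n f : Ck n.+1 f -> Ck n f.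
Proof. by elim: n f => // n IH f [g fg /IH]; exists g. Qed.

(** [Ck] offers a derivative for each n separately; by uniqueness all of them are ['D_1 f], so that
    one witness serves every n. *)
Lemma smooth1_derive f : smooth1 f ->
  exists2 g, (forall x : R, is_derive x 1 f (g x)) & smooth1 g.
Proof.
move=> sf; exists (fun x => 'D_1 f x).
  by move=> x; have [g /(_ x) [fx gx] _] := sf 1%N; split.
move=> n; have [g fg gn] := sf n.+1.
rewrite (_ : (fun x => _) = g)//; apply/funext => x.
by have fgx := fg x; rewrite derive_val.
Qed.

Lemma smooth1_primitive f g : smooth1 g ->
  (forall x : R, is_derive x 1 f (g x)) -> smooth1 f.
Proof. by move=> sg fg [//|n]; exists g. Qed.

Lemma smooth1_continuous f : smooth1 f -> continuous f.
Proof. by move=> /smooth1_derive[g fg _]; exact: is_derive_continuous fg. Qed.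

Lemma Ck_cst n (c : R) : Ck n (fun=> c).
Proof.
elim: n c => // n IH c; exists (fun=> 0) => // x; exact: is_derive_cst.
Qed.

Lemma CkD n f g : Ck n f -> Ck n g -> Ck n (fun x => f x + g x).
Proof.
elim: n f g => // n IH f g [f' ff' nf'] [g' gg' ng'].
exists (fun x => f' x + g' x); last exact: IH.
by move=> x; have := ff' x; have := gg' x => ? ?; exact: is_deriveD.
Qed.

Lemma CkM n f g : Ck n f -> Ck n g -> Ck n (fun x => f x * g x).
Proof.
elim: n f g => // n IH f g Cf Cg.
have [f' ff' nf'] := Cf; have [g' gg' ng'] := Cg.
exists (fun x => f x * g' x + g x * f' x).
  by move=> x; have := ff' x; have := gg' x => ? ?; exact: is_deriveM.
by apply: CkD; apply: IH => //; exact: Ck_pred.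
Qed.

Lemma is_derive_affine f (df : R) (a b x : R) :
  is_derive (a * x + b) 1 f df ->
  is_derive x 1 (fun y => f (a * y + b)) (a * df).
Proof.
move=> [fd <-].
have ad : is_derive x 1 (fun y : R => a * y + b) (a *: 1).
  by rewrite -[a *: 1]addr0; apply: is_deriveD.
have add : derivable (fun y : R => a * y + b) x 1 by case: ad.
have := @derive1_comp R (fun y => a * y + b) f x add fd.
rewrite !derive1E => dE; split; last first.
  by rewrite [LHS]dE derive_val [a *: 1]mulr1 mulrC.
apply/derivable1_diffP/differentiable_comp; exact/derivable1_diffP.
Qed.

Lemma Ck_affine n f (a b : R) : Ck n f -> Ck n (fun x => f (a * x + b)).
Proof.
elim: n f => // n IH f [g fg ng]; exists (fun x => a * g (a * x + b)).
  by move=> x; exact: is_derive_affine.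
by apply: CkM; [exact: Ck_cst|exact: IH].
Qed.

Lemma smooth1_cst (c : R) : smooth1 (fun=> c).
Proof. by move=> n; exact: Ck_cst. Qed.

Lemma smooth1D f g : smooth1 f -> smooth1 g -> smooth1 (fun x => f x + g x).
Proof. by move=> sf sg n; exact: CkD. Qed.

Lemma smooth1M f g : smooth1 f -> smooth1 g -> smooth1 (fun x => f x * g x).
Proof. by move=> sf sg n; exact: CkM. Qed.

Lemma smooth1_affine f (a b : R) : smooth1 f ->
  smooth1 (fun x => f (a * x + b)).
Proof. by move=> sf n; exact: Ck_affine. Qed.

(** The classical flat function exp(-1/x), with a factor x^(-k) that closes the family under linear
    combinations of derivatives: smoothness becomes a single induction for all k. *)
Definition flat (k : nat) (x : R) : R :=
  if 0 < x then x^-1 ^+ k * expR (- x^-1) else 0.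

Lemma flat_ge0 k x : 0 <= flat k x.
Proof.
by rewrite /flat; case: ifP => // x0;
  rewrite mulr_ge0 ?expR_ge0// exprn_ge0// invr_ge0 ltW.
Qed.

(** From y^(k+1) / (k+1)! <= exp y at y = 1/x. At 0 the difference quotient of [flat k] has absolute
    value [flat k.+1], so this bound gives it the limit 0. *)
Lemma flat_le k x : flat k x <= (k.+1)`!%:R * `|x|.
Proof.
rewrite /flat; case: ifP => x0; last by rewrite mulr_ge0.
rewrite gtr0_norm// expRN.
have y0 : 0 < x^-1 by rewrite invr_gt0.
have e1 := @expR_ge1Dxn R x^-1 k (ltW y0).
rewrite ler_pdivrMr ?expR_gt0//.
apply: (@le_trans _ _ (k.+1`!%:R * x * (x^-1 ^+ k.+1 / k.+1`!%:R))); last first.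
  rewrite ler_wpM2l// ?mulr_ge0// ?(ltW x0)//.
  by apply: le_trans e1; rewrite lerDr.
rewrite exprS mulrAC [_ * x]mulrC.
have f0 : (k.+1`!%:R : R) != 0 by rewrite pnatr_eq0 -lt0n fact_gt0.
have xn0 : x != 0 by rewrite gt_eqF.
rewrite le_eqVlt; apply/orP; left; apply/eqP.
by field; rewrite f0 xn0.
Qed.

Lemma flat_derive k (x : R) :
  is_derive x 1 (flat k) (flat k.+2 x - k%:R * flat k.+1 x).
Proof.
have [x0|x0|->] := ltgtP x 0.
- rewrite {2 3}/flat ltNge (ltW x0)/= mulr0 subr0.
  apply: (@near_eq_is_derive _ _ _ (fun=> 0)).
  by near=> y; rewrite /flat ltNge ltW//; near: y; exact: lt_nbhsl.
- rewrite {2 3}/flat x0.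
  apply: (@near_eq_is_derive _ _ _ (fun y : R => y^-1 ^+ k * expR (- y^-1))).
    by near=> y; rewrite /flat ifT//; near: y; exact: lt_nbhsr.
  have xn0 : x != 0 by rewrite gt_eqF.
  have di : is_derive x 1 (fun y : R => y^-1) (- x^-1 ^+ 2).
    split; first exact: (@derivableV _ _ id).
    by rewrite (@deriveV _ _ id)// derive_id [_ *: _]mulr1 exprVn.
  have de : is_derive x 1 (fun y : R => expR (- y^-1))
    (x^-1 ^+ 2 * expR (- x^-1)).
    have dN : is_derive x 1 (fun y : R => - y^-1) (x^-1 ^+ 2).
      by rewrite -[X in is_derive _ _ _ X]opprK; exact: is_deriveN.
    have [dN1 dN2] := dN.
    have eD := @derivable_expR R (- x^-1).
    have := derive1_comp dN1 eD;
      rewrite !derive1E dN2 (derive_val (f := expR)) => E.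
    split; last by rewrite [LHS]E mulrC.
    by apply/derivable1_diffP/differentiable_comp; exact/derivable1_diffP.
  have dX := @is_deriveX _ _ _ k _ _ _ di.
  have := @is_deriveM _ _ _ _ _ _ _ _ dX de.
  rewrite (_ : _ * _ = fun y => y^-1 ^+ k * expR (- y^-1)); last first.
    by apply/funext => y /=; rewrite !fctE.
  move=> h; apply: is_derive_eq h _.
  rewrite !fctE /GRing.scale/=.
  case: k {dX} => [|k]; first by rewrite /= !expr0; ring.
  rewrite /= !exprS; ring.
- rewrite {2 3}/flat ltxx mulr0 subr0.
  have c0 : h^-1 *: (flat k (h *: 1 + 0) - flat k 0) @[h --> 0^'] --> (0 : R).
    apply/cvgr0Pnorm_lt => e e0; near=> h.
    rewrite [h *: 1]mulr1 addr0 {2}/flat ltxx subr0.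
    have hn0 : h != 0 by near: h; exact: nbhs_dnbhs_neq.
    have -> : `|h^-1 *: flat k h| = flat k.+1 h.
      rewrite /flat; case: ifP => h0; last by rewrite scaler0 normr0.
      rewrite normrM gtr0_norm ?invr_gt0// ger0_norm; last first.
        by rewrite mulr_ge0 ?expR_ge0// exprn_ge0// invr_ge0 ltW.
      by rewrite exprS mulrA.
    apply: le_lt_trans (flat_le _ _) _.
    rewrite mulrC -ltr_pdivlMr ?ltr0n ?fact_gt0//.
    by near: h; apply: dnbhs0_lt; rewrite divr_gt0// ltr0n fact_gt0.
  split; first by apply/cvg_ex; exists 0.
  exact/cvg_lim.
Unshelve. all: by end_near. Qed.

Lemma smooth1_flat k : smooth1 (flat k).
Proof.
move=> n; elim: n k => // n IH k.
exists (fun x => flat k.+2 x - k%:R * flat k.+1 x); first exact: flat_derive.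
apply: (CkD (IH _)).
rewrite (_ : (fun x => _) = fun x => (- k%:R) * flat k.+1 x); last first.
  by apply/funext => x; rewrite mulNr.
by apply: CkM; [exact: Ck_cst|exact: IH].
Qed.

Let mu := @lebesgue_measure R.

(** The integral from -n is a primitive only to the right of -n. Normalized to vanish at 0, these
    primitives agree wherever two of them apply, so they glue: at x the one with index [N x] > |x|
    is used, and it is still valid near x. *)
Lemma continuous_primitive f : continuous f ->
  exists F : R -> R, forall x : R, is_derive x 1 F (f x).
Proof.
move=> cf.
have fint a b : mu.-integrable `[a, b] (EFin \o f).
  apply: continuous_compact_integrable; first exact: segment_compact.
  exact: continuous_subspaceT.
pose I n (x : R) := \int[mu]_(t in `[- n%:R, x]) f t.
pose G n x := I n x - I n 0.
have IE m n x : (n <= m)%N -> - n%:R <= x ->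
    I m x - I m (- n%:R) = \int[mu]_(t in `](- n%:R), x]) f t.
  move=> nm nx; rewrite /I.
  have := @Rintegral_itvB R f (BLeft (- m%:R)) (BRight x) (- n%:R).
  apply => //; rewrite bnd_simp//.
  by rewrite lerN2 ler_nat.
have GE m n x : (n <= m)%N -> - n%:R <= x -> G m x = G n x.
  move=> nm nx; rewrite /G.
  have n0 : - n%:R <= 0 :> R by rewrite oppr_le0.
  have := IE m n x nm nx; have := IE m n 0 nm n0.
  have := IE n n x (leqnn n) nx; have := IE n n 0 (leqnn n) n0.
  lra.
have Gd n (x : R) : - n%:R < x -> is_derive x 1 (G n) (f x).
  move=> nx.
  have x1 : x < x + 1 by rewrite ltrDl.
  have [] := @continuous_FTC1_closed R f (- n%:R) x (x + 1) x1 (fint _ _) nx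
    (cf x).
  rewrite derive1E -/(I n) => Id Ie.
  rewrite -[f x]subr0; apply: is_deriveB; exact: DeriveDef.
pose N (x : R) := (Num.trunc `|x|).+1.
have xN x : - (N x)%:R < x.
  by rewrite ltrNl (le_lt_trans (ler_norm _))// normrN /N truncnS_gt.
exists (fun x => G (N x) x) => x.
apply: (@near_eq_is_derive _ _ _ (G (N x))); last exact: Gd.
near=> y.
have yx : - (N x)%:R < y by near: y; exact: lt_nbhsr.
have [h|h] := leqP (N x) (N y); first by rewrite (GE _ _ _ h)// ltW.
by rewrite (GE _ _ _ (ltnW h))// ltW.
Unshelve. all: by end_near. Qed.

Lemma smooth1_antiderivative f : smooth1 f ->
  exists2 F, smooth1 F & forall x : R, is_derive x 1 F (f x).
Proof.
move=> sf; have [F FE] := continuous_primitive (smooth1_continuous sf).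
by exists F => //; exact: smooth1_primitive FE.
Qed.

(** The normalized primitive of the bump [flat 0 x * flat 0 (1 - x)], which is supported in
    [0, 1]. *)
Lemma smooth1_step : exists S : R -> R,
  [/\ smooth1 S, forall x, x <= 0 -> S x = 0, forall x, 1 <= x -> S x = 1
    & forall x, 0 <= S x <= 1].
Proof.
pose b (x : R) : R := flat 0 x * flat 0 ((-1) * x + 1).
have sb : smooth1 b.
  by apply: smooth1M; [|apply: smooth1_affine]; exact: smooth1_flat.
have b0 x : 0 <= b x by rewrite mulr_ge0// flat_ge0.
have [F sF FE] := smooth1_antiderivative sb.
have Fnd x y : x <= y -> F x <= F y.
  move=> xy; have [c _ E] := mean_value xy FE.
  by rewrite -subr_ge0 E mulr_ge0// subr_ge0.
have FL x : x <= 0 -> F x = F 0.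
  move=> x0; have [c /andP[_ c0] E] := mean_value x0 FE.
  apply/eqP; rewrite eq_sym -subr_eq0 E /b {1}/flat ltNge c0/=.
  by rewrite !mul0r.
have FR x : 1 <= x -> F x = F 1.
  move=> x1; have [c /andP[c1 _] E] := mean_value x1 FE.
  apply/eqP; rewrite -subr_eq0 E /b {2}/flat ifF ?mulr0 ?mul0r//.
  by apply/negbTE; rewrite -leNgt; lra.
have F01 : F 0 < F 1.
  (* Monotonicity only gives F 0 <= F 1; strictness comes from [1/4, 3/4], where the bump is
     positive. *)
  have h1 : 1/4 <= 3/4 :> R by lra.
  have [c /andP[c1 c3] E] := mean_value h1 FE.
  have : 0 < F (3/4) - F (1/4).
    rewrite E mulr_gt0//; last lra.
    rewrite /b /flat !ifT; [|lra|lra].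
    by rewrite !expr0 !mul1r mulr_gt0// expR_gt0.
  have h2 : 0 <= 1/4 :> R by lra.
  have h3 : 3/4 <= 1 :> R by lra.
  have := Fnd _ _ h2; have := Fnd _ _ h3; lra.
have d0 : 0 < F 1 - F 0 by rewrite subr_gt0.
exists (fun x => (F 1 - F 0)^-1 * (F x + - F 0)); split.
- apply: smooth1M; first exact: smooth1_cst.
  by apply: smooth1D => //; exact: smooth1_cst.
- by move=> x /FL ->; rewrite subrr mulr0.
- by move=> x /FR ->; rewrite mulVf// gt_eqF.
- move=> x; rewrite mulrC divr_ge0/= ?(ltW d0)//; last first.
    rewrite subr_ge0; have [x0|x0] := leP x 0; first by rewrite FL.
    exact/Fnd/ltW.
  rewrite ler_pdivrMr// mul1r lerB//.
  have [x0|x0] := leP x 1; first exact/Fnd.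
  by rewrite (FR x)// ltW.
Qed.

End smooth1.

(** * Sums of products of smooth functions *)

Section tensor.
Context {R : realType} {d : nat}.
Implicit Types (eta : 'rV[R]_d -> R) (x v : 'rV[R]_d) (chi : 'I_d -> R -> R).

(** The difference quotients of [F] at [x] along [v] and of [G] at [t] are the same function of
    h. *)
Lemma is_derive_line (F : 'rV[R]_d -> R) (G : R -> R) x v (t df : R) :
  (forall h, F (h *: v + x) = G (h + t)) ->
  is_derive t 1 G df -> is_derive x v F df.
Proof.
move=> FG [Gd <-].
have E : (fun h : R => h^-1 *: ((F \o shift x) (h *: v) - F x)) =
         (fun h : R => h^-1 *: ((G \o shift t) (h *: (1 : R)) - G t)).
  apply/funext => h; rewrite /= FG.
  have -> : F x = G t by have := FG 0; rewrite scale0r !add0r.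
  by rewrite [h *: 1]mulr1.
by split; [rewrite /derivable E|rewrite /derive E].
Qed.

(* Finite sums of products of smooth functions of one coordinate: they are
   stable under antidifferentiation in any direction, and rich enough to
   approximate indicators. *)
Inductive tensor : ('rV[R]_d -> R) -> Prop :=
| tensor0 : tensor (fun=> 0)
| tensor_cons chi eta : (forall j, smooth1 (chi j)) -> tensor eta ->
    tensor (fun x => \prod_j chi j (x 0 j) + eta x).

Lemma tensorD eta eta' : tensor eta -> tensor eta' ->
  tensor (fun x => eta x + eta' x).
Proof.
move=> + t'; elim => [|chi {}eta s _ IH].
  by rewrite (_ : (fun x => _) = eta')//; apply/funext => x; rewrite add0r.
rewrite [X in tensor X](_ : _ =
  fun x => \prod_j chi j (x 0 j) + (eta x + eta' x)); first exact: tensor_cons.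
by apply/funext => x; rewrite addrA.
Qed.

Lemma tensor_prod chi : (forall j, smooth1 (chi j)) ->
  tensor (fun x => \prod_j chi j (x 0 j)).
Proof.
move=> s; have := tensor_cons s tensor0.
by congr tensor; apply/funext => x; rewrite addr0.
Qed.

Lemma tensorM eta eta' : tensor eta -> tensor eta' ->
  tensor (fun x => eta x * eta' x).
Proof.
move=> + t'; elim => [|chi {}eta s _ IH].
  rewrite (_ : (fun x => _) = fun=> 0); first exact: tensor0.
  by apply/funext => x; rewrite mul0r.
rewrite [X in tensor X](_ : _ =
  fun x => (\prod_j chi j (x 0 j)) * eta' x + (eta x * eta' x)); last first.
  by apply/funext => x; rewrite mulrDl.
apply: tensorD => // {eta IH}; elim: t' => [|chi' eta s' _ IH].
  rewrite (_ : (fun x => _) = fun=> 0); first exact: tensor0.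
  by apply/funext => x; rewrite mulr0.
rewrite [X in tensor X](_ : _ =
  fun x => \prod_j (chi j (x 0 j) * chi' j (x 0 j)) +
           (\prod_j chi j (x 0 j)) * eta x); last first.
  by apply/funext => x; rewrite big_split/= mulrDr.
apply: (@tensor_cons (fun j t => chi j t * chi' j t)) => // j.
exact: smooth1M.
Qed.

Lemma tensor_coord (i : 'I_d) (f : R -> R) : smooth1 f ->
  tensor (fun x => f (x 0 i)).
Proof.
move=> sf; rewrite [X in tensor X](_ : _ =
  fun x => \prod_j (if j == i then f else fun=> 1) (x 0 j)).
  apply: (@tensor_prod (fun j => if j == i then f else fun=> 1)) => j.
  by case: ifP => // _; exact: smooth1_cst.
apply/funext => x; rewrite (bigD1 i)//= eqxx big1 ?mulr1// => j.
by move/negbTE => ->.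
Qed.

(** The factor at coordinate [i] carries the constant. Without coordinates the only tensors would be
    natural numbers, whence the [i0 : 'I_d] carried by later sections. *)
Lemma tensor_cst (i : 'I_d) (c : R) : tensor (fun=> c).
Proof. exact: (@tensor_coord i (fun=> c) (smooth1_cst c)). Qed.

Lemma tensor_shift v eta : tensor eta -> tensor (fun x => eta (x + v)).
Proof.
elim => [|chi {}eta s _ IH]; first exact: tensor0.
rewrite [X in tensor X](_ : _ =
  fun x => \prod_j chi j (1 * x 0 j + v 0 j) + eta (x + v)); last first.
  apply/funext => x; congr (_ + _); apply: eq_bigr => j _.
  by rewrite mxE mul1r.
apply: (@tensor_cons (fun j t => chi j (1 * t + v 0 j))) => // j.
exact: smooth1_affine.
Qed.

Lemma is_derive_prod_coord (i : 'I_d) chi (g dg : R -> R) x :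
  (forall t : R, is_derive t 1 g (dg t)) ->
  is_derive x (delta_mx 0 i)
    (fun x => \prod_j (if j == i then g else chi j) (x 0 j))
    (\prod_j (if j == i then dg else chi j) (x 0 j)).
Proof.
move=> gd; pose c := \prod_(j | j != i) chi j (x 0 j).
apply: (@is_derive_line _ (fun t => c * g t) x _ (x 0 i)).
  move=> h; rewrite (bigD1 i)//= eqxx mulrC; congr (_ * _).
    apply: eq_bigr => j ji; rewrite (negbTE ji).
    by rewrite !mxE eqxx (negbTE ji) mulr0 add0r.
  by rewrite !mxE !eqxx mulr1.
rewrite (bigD1 i)//= eqxx mulrC.
rewrite (_ : \prod_(_ | _) _ = c); last first.
  by apply: eq_bigr => j /negbTE ->.
exact: is_deriveZ.
Qed.

Let split_coord (i : 'I_d) chi x : \prod_j chi j (x 0 j) =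
  \prod_j (if j == i then chi i else chi j) (x 0 j).
Proof. by apply: eq_bigr => j _; case: eqP => // ->. Qed.

Lemma tensor_partial (i : 'I_d) eta : tensor eta ->
  exists2 eta', tensor eta' &
    forall x, is_derive x (delta_mx 0 i) eta (eta' x).
Proof.
elim => [|chi {}eta s _ [eta' t' etaE]].
  by exists (fun=> 0); [exact: tensor0|move=> x; exact: is_derive_cst].
have [g gE sg] := smooth1_derive (s i).
exists (fun x => \prod_j (if j == i then g else chi j) (x 0 j) + eta' x).
  apply: (@tensor_cons (fun j => if j == i then g else chi j)) => // j.
  by case: ifP.
move=> x; apply: is_deriveD => //.
rewrite [X in is_derive _ _ X _](_ : _ = fun y : 'rV[R]_d => \prod_j
  (if j == i then chi i else chi j) (y 0 j)).
  exact: is_derive_prod_coord.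
by apply/funext => y; exact: split_coord.
Qed.

Lemma tensor_antiderivative (i : 'I_d) eta : tensor eta ->
  exists2 Q, tensor Q & forall x, is_derive x (delta_mx 0 i) Q (eta x).
Proof.
elim => [|chi {}eta s _ [Q tQ QE]].
  by exists (fun=> 0); [exact: tensor0|move=> x; exact: is_derive_cst].
have [G sG GE] := smooth1_antiderivative (s i).
exists (fun x => \prod_j (if j == i then G else chi j) (x 0 j) + Q x).
  apply: (@tensor_cons (fun j => if j == i then G else chi j)) => // j.
  by case: ifP.
move=> x; apply: is_deriveD => //.
rewrite (split_coord i).
exact: is_derive_prod_coord.
Qed.

Lemma tensor_continuous eta : tensor eta -> continuous eta.
Proof.
elim => [|chi {}eta s _ IH]; first exact: cst_continuous.
move=> x.
have cP r : continuous (fun y : 'rV[R]_d => \prod_(j <- r) chi j (y 0 j)).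
  elim: r => [|j r IHr].
    under eq_fun do rewrite big_nil.
    exact: cst_continuous.
  under eq_fun do rewrite big_cons.
  move=> z; apply: continuousM; last exact: IHr.
  apply: (@continuous_comp _ _ _ (fun y : 'rV[R]_d => y 0 j) (chi j)).
    exact: coord_continuous.
  exact: smooth1_continuous.
exact: (continuousD (cP (index_enum _) x) (IH x)).
Qed.

Lemma tensor_smooth eta : tensor eta -> smooth eta.
Proof.
move=> teta s; set g := foldr _ _ _ => /=.
suff tg : tensor g.
  split; first exact: tensor_continuous.
  by move=> i x; have [eta' _ /(_ x)[]] := tensor_partial i tg.
rewrite {}/g; elim: s => [//|i s IH] /=.
have [eta' t' etaE] := tensor_partial i IH.
rewrite (_ : partial i _ = eta')//; apply/funext => x.
by have eE := etaE x; rewrite /partial derive_val.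
Qed.

End tensor.

(** * Lebesgue measure on row vectors *)

Section lebesgue_rV_theory.
Context {R : realType}.

(** The measurable sets are generated by coordinates, the open ones by the maximum norm. They meet
    in the countably many cubes with rational centre and radius 1/(k+1), whose union over those
    inside U is U. *)
Lemma open_measurable_rV d (U : set 'rV[R]_d) : open U -> measurable U.
Proof.
move=> oU.
pose B (p : 'rV[rat]_d * nat) : set 'rV[R]_d :=
  \bigcap_(i in [set: 'I_d]) ((@rV_coord R d i) @^-1`
     ball (ratr (p.1 0 i) : R) (p.2.+1%:R^-1)).
have mB p : measurable (B p).
  apply: fin_bigcap_measurable => // i _.
  rewrite -[X in measurable X]setTI; apply: measurable_rV_coord => //.
  exact: measurable_ball.
rewrite (_ : U = \bigcup_(p in [set p | B p `<=` U]) B p); last first.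
  apply/seteqP; split => [x Ux|x [p pU /pU//]].
  have /nbhs_ballP[e /= e0 xeU] : nbhs x U by exact: open_nbhs_nbhs.
  have e2 : 0 < (e / 2)^-1 by rewrite invr_gt0 divr_gt0.
  pose k := Num.trunc (e / 2)^-1.
  have ke : (k.+1%:R)^-1 < e / 2.
    by rewrite -[ltRHS]invrK ltf_pV2 ?posrE ?ltr0n// truncnS_gt.
  have k0 : 0 < (k.+1%:R)^-1 :> R by rewrite invr_gt0 ltr0n.
  have /choice[q qP] (i : 'I_d) : exists q : rat,
      `|x 0 i - ratr q| < k.+1%:R^-1.
    have xk : x 0 i - k.+1%:R^-1 < x 0 i + k.+1%:R^-1.
      by rewrite ltrD2l (lt_trans _ k0)// oppr_lt0.
    have [q] := rat_in_itvoo xk.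
    rewrite in_itv/= => /andP[q1 q2]; exists q.
    by rewrite ltr_norml ltrBrDr addrC ltrBlDr q2/= ltrBlDr addrC -ltrBlDr.
  exists (\row_i q i, k).
    move=> y By; apply: xeU; split => // i j; rewrite ord1.
    have := By j I; rewrite /= /ball/= mxE /rV_coord => yj.
    rewrite -(subrKA (ratr (q j))) [e]splitr (le_lt_trans (ler_normD _ _))//.
    apply: ltrD; first exact: lt_trans (qP j) ke.
    exact: lt_trans yj ke.
  by move=> i _; rewrite /= /ball/= mxE distrC; exact: qP.
rewrite bigcup_mkcond.
rewrite (_ : \bigcup_p _ = \bigcup_n (if unpickle n is Some p then
   (if p \in [set p | B p `<=` U] then B p else set0) else set0)).
  by apply: bigcupT_measurable => n; case: unpickle => // p; case: ifP.
apply/seteqP; split => [x [p _ pB]|x [n _]].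
  by exists (pickle p) => //; rewrite pickleK.
by case: unpickle => // p pB; exists p.
Qed.

Lemma continuous_measurable_rV d (f : 'rV[R]_d -> R) :
  continuous f -> measurable_fun [set: 'rV[R]_d] f.
Proof.
move=> cf; apply: (measurability _ (RGenOInfty.measurableE R)).
move=> _ [_ [x ->] <-]; rewrite setTI; apply: open_measurable_rV.
apply: open_comp => // y _; exact: cf.
Qed.

Lemma measurable_rV_shift d (v : 'rV[R]_d) :
  measurable_fun [set: 'rV[R]_d] (fun x => x + v).
Proof.
apply: measurable_fun_rVP => i.
rewrite (_ : _ \o _ = fun x => rV_coord i x + v 0 i); last first.
  by apply/funext => x; rewrite /rV_coord/= mxE.
exact: measurable_funD (measurable_rV_coord i) (measurable_cst _).
Qed.

Lemma lebesgue_measure_shift (t : R) (A : set (measurableTypeR R)) :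
  measurable A ->
  lebesgue_measure ((fun x => x + t) @^-1` A) = lebesgue_measure A.
Proof.
move=> mA.
have ms : measurable_fun [set: measurableTypeR R]
    (fun x : measurableTypeR R => (x + t : measurableTypeR R)).
  exact: measurable_funD.
apply/esym.
apply: (lebesgue_measure_unique (mu :=
  measure_function_pushforward__canonical__measure_function_Measure
    lebesgue_measure ms)) => //= _ [[a b]] _ <-.
rewrite /pushforward (_ : _ @^-1` _ = `]a - t, b - t]%classic).
  rewrite !lebesgue_measure_itv/= !lte_fin ltrD2r; case: ifP => // _.
  by rewrite -!EFinB; congr (_%:E); ring.
by apply/seteqP; split => x /=; rewrite !in_itv/=; lra.
Qed.

(** Through [rV_cons] the translation becomes the product [T] of two translations. The image under
    [T] of the product measure agrees with it on measurable rectangles, hence everywhere. *)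
Lemma lebesgue_rV_shift d (v : 'rV[R]_d) A : measurable A ->
  lebesgue_rV R d ((fun x => x + v) @^-1` A) = lebesgue_rV R d A.
Proof.
elim: d v A => [|d IH] v A mA.
  rewrite (_ : _ @^-1` _ = A)//; apply/seteqP.
  by split => x /=; rewrite (_ : x + v = x)//; apply/rowP => -[].
rewrite /= /lebesgue_rV_succ /pushforward.
pose w : 'rV[R]_d := rsubmx (v : 'rV[R]_(1 + d)).
pose T (p : measurableTypeR R * 'rV[R]_d) : measurableTypeR R * 'rV[R]_d :=
  (p.1 + v 0 0, p.2 + w).
have mT : measurable_fun setT T.
  apply/measurable_fun_pairP; split.
    by apply: measurable_funD => //; exact: measurable_fst.
  by apply: (measurableT_comp (measurable_rV_shift w)); exact: measurable_snd.
have consT p : rV_cons p + v = rV_cons (T p).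
  rewrite -[LHS]rV_unconsK; congr rV_cons; rewrite /rV_uncons /T /w.
  case: p => t z /=; have [c1 c2] := rV_consK (t, z).
  congr pair; first by rewrite mxE c1.
  by rewrite -[in RHS]c2; apply/rowP => i; rewrite !mxE.
rewrite (_ : _ @^-1` (_ @^-1` A) = T @^-1` (@rV_cons R d @^-1` A)); last first.
  by apply/seteqP; split => p /=; rewrite consT.
apply/esym.
apply: (@product_measure_unique _ _ _ _ R lebesgue_measure (lebesgue_rV R d)
 (measure_function_pushforward__canonical__measure_function_Measure
    (lebesgue_measure \x lebesgue_rV R d)%E mT)).
  move=> B C mB mC /=; rewrite /pushforward.
  rewrite (_ : T @^-1` _ = ((fun x => x + v 0 0) @^-1` B) `*`
     ((fun x => x + w) @^-1` C))//.
  rewrite product_measure1E//.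
  - by congr (_ * _)%E; [exact: lebesgue_measure_shift|exact: IH].
  - rewrite -[X in measurable X]setTI.
    have : measurable_fun [set: measurableTypeR R]
        (fun x : measurableTypeR R => (x + v 0 0 : measurableTypeR R)).
      exact: measurable_funD.
    exact.
  - by rewrite -[X in measurable X]setTI; exact: measurable_rV_shift.
rewrite -[X in measurable X]setTI; exact: measurable_rV_cons.
Qed.

Section shift_integral.
Variables (d : nat) (v : 'rV[R]_d).
Notation mu := (lebesgue_rV R d).
Let s (x : 'rV[R]_d) := x + v.
Let ms : measurable_fun setT s. Proof. exact: measurable_rV_shift. Qed.

Let ge0_integral_shift (f : 'rV[R]_d -> \bar R) : measurable_fun setT f ->
  (forall x, (0 <= f x)%E) ->
  (\int[mu]_x f (x + v)%R = \int[mu]_x f x)%E.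
Proof.
move=> mf f0.
transitivity (\int[pushforward mu s]_x f x)%E.
  by rewrite ge0_integral_pushforward//= preimage_setT.
by apply: eq_measure_integral => A mA _; exact: lebesgue_rV_shift.
Qed.

Lemma integrable_shift (f : 'rV[R]_d -> R) :
  mu.-integrable setT (EFin \o f) ->
  mu.-integrable setT (fun x => (f (x + v))%:E).
Proof.
move=> /integrableP[mf foo]; apply/integrableP; split.
  exact: measurableT_comp mf ms.
rewrite (@ge0_integral_shift (fun x => `|(f x)%:E|%E))//.
exact: measurableT_comp.
Qed.

Lemma Rintegral_shift (f : 'rV[R]_d -> R) :
  mu.-integrable setT (EFin \o f) ->
  \int[mu]_x f (x + v) = \int[mu]_x f x.
Proof.
move=> fi; rewrite /Rintegral; congr fine.
transitivity (\int[pushforward mu s]_x (f x)%:E)%E.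
  rewrite (@integral_pushforward _ _ _ _ _ _ ms mu setT (EFin \o f))//.
  - exact: measurable_int fi.
  - by rewrite preimage_setT; exact: integrable_shift.
by apply: eq_measure_integral => A mA _; exact: lebesgue_rV_shift.
Qed.

End shift_integral.
End lebesgue_rV_theory.

(** * Approximation of signs by smooth functions *)

Section Rintegral_facts.
Context {dT : measure_display} {T : measurableType dT} {R : realType}.
Variable mu : {measure set T -> \bar R}.
Implicit Types (w b : T -> R).

Lemma integrable_bounded_mul w b (M : R) :
  mu.-integrable setT (EFin \o w) -> measurable_fun setT b ->
  (forall x, `|b x| <= M) -> mu.-integrable setT (fun x => (w x * b x)%:E).
Proof.
move=> wi mb bM; have := integrableZl measurableT M wi.
apply: le_integrable => //.
  apply/measurable_EFinP/measurable_funM => //.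
  exact/measurable_EFinP/(measurable_int mu).
move=> x _; rewrite /= !normrM lee_fin mulrC ler_wpM2r//.
exact: le_trans (bM x) (ler_norm _).
Qed.

Lemma integrable_add w b :
  mu.-integrable setT (fun x => (w x)%:E) ->
  mu.-integrable setT (fun x => (b x)%:E) ->
  mu.-integrable setT (fun x => (w x + b x)%:E).
Proof. by move=> wi bi; apply: eq_integrable (integrableD _ wi bi). Qed.

Lemma integrable_normr w :
  mu.-integrable setT (EFin \o w) -> mu.-integrable setT (fun x => `|w x|%:E).
Proof. exact: integrable_norm. Qed.

Lemma cvg_Rintegral (f_ : nat -> T -> R) (f g : T -> R) :
  (forall n, measurable_fun setT (f_ n)) ->
  (forall x, f_ ^~ x @ \oo --> f x) ->
  mu.-integrable setT (EFin \o g) -> (forall n x, `|f_ n x| <= g x) ->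
  mu.-integrable setT (EFin \o f) /\
  \int[mu]_x f_ n x @[n --> \oo] --> \int[mu]_x f x.
Proof.
move=> mf ff ig fg.
have mff : measurable_fun setT f by apply: (measurable_fun_cvg mf) => x _.
have [] := @dominated_convergence _ _ _ mu setT measurableT
  (fun n x => (f_ n x)%:E) (EFin \o f) (EFin \o g).
- by move=> n; exact/measurable_EFinP.
- exact/measurable_EFinP.
- by apply: aeW => x _; apply: cvg_EFin; [exact: nearW|exact: ff].
- exact: ig.
- by apply: aeW => x n _; rewrite lee_fin.
move=> fi _ fc; split => //.
apply: fine_cvg; rewrite fineK; first exact: fc.
exact: integrable_fin_num.
Qed.

End Rintegral_facts.

Section approximation.
Context {R : realType} {d : nat} (i0 : 'I_d).
Notation mu := (lebesgue_rV R d).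
Implicit Types (eta w : 'rV[R]_d -> R) (A : set 'rV[R]_d).

Lemma tensor_measurable eta : tensor eta -> measurable_fun setT eta.
Proof. by move=> /tensor_continuous /continuous_measurable_rV. Qed.

Section indicator.
Variable w : 'rV[R]_d -> R.
Hypothesis wi : mu.-integrable setT (EFin \o w).

Let dist (f g : 'rV[R]_d -> R) : R := \int[mu]_x (`|w x| * `|f x - g x|).

Let unit_valued (f : 'rV[R]_d -> R) :=
  measurable_fun setT f /\ forall x, 0 <= f x <= 1.

Let dist_integrable f g : unit_valued f -> unit_valued g ->
  mu.-integrable setT (fun x => (`|w x| * `|f x - g x|)%:E).
Proof.
move=> [mf f01] [mg g01]; apply: (@integrable_bounded_mul _ _ _ _ _ _ 1).
- exact: integrable_normr.
- by apply: measurableT_comp => //; exact: measurable_funB.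
- by move=> x; rewrite normr_id ler_norml; have := f01 x; have := g01 x; lra.
Qed.

Let distD f g h : unit_valued f -> unit_valued g -> unit_valued h ->
  dist f h <= dist f g + dist g h.
Proof.
move=> uf ug uh; rewrite /dist -RintegralD//; try exact: dist_integrable.
apply: le_Rintegral => //; first exact: dist_integrable.
  by apply: integrable_add; exact: dist_integrable.
by move=> x _; rewrite -mulrDr ler_wpM2l// -(subrKA (g x) (f x)) ler_normD.
Qed.

Let indic_unit A : measurable A -> unit_valued (\1_A).
Proof.
by move=> mA; split => // x; rewrite indicE; case: (x \in A);
  rewrite lexx ler01.
Qed.

(** Sets whose indicator is a limit, in L^1 with weight |w|, of tensors with values in [0, 1]. The
    weight has finite mass, so dominated convergence makes this class a sigma-algebra; the range is
    recorded because 2 eta - 1 must stay within [-1, 1] later. *)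
Let approx : set (set 'rV[R]_d) :=
  [set A | measurable A /\ forall e, 0 < e -> exists eta,
    [/\ tensor eta, forall x, 0 <= eta x <= 1 & dist eta (\1_A) <= e]].

Let tensor_unit eta : tensor eta -> (forall x, 0 <= eta x <= 1) ->
  unit_valued eta.
Proof. by move=> te e01; split => //; exact: tensor_measurable. Qed.

Let approxC A : approx A -> approx (~` A).
Proof.
move=> [mA appA]; split; first exact: measurableC.
move=> e e0; have [eta [te e01 etaA]] := appA e e0.
exists (fun x => 1 + (-1) * eta x); split.
- by apply: tensorD;
  [exact: tensor_cst|apply: tensorM => //; exact: tensor_cst].
- by move=> x; have := e01 x; lra.
- apply: le_trans etaA; rewrite /dist le_eqVlt; apply/orP; left; apply/eqP.
  apply: eq_Rintegral => x _; congr (_ * _).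
  rewrite -[RHS]normrN !indicE in_setC; case: (x \in A) => /=; congr `|_|; ring.
Qed.

Let approxU A B : approx A -> approx B -> approx (A `|` B).
Proof.
move=> [mA appA] [mB appB]; split; first exact: measurableU.
move=> e e0; have e20 : 0 < e / 2 by rewrite divr_gt0.
have [eta [te e01 etaA]] := appA _ e20.
have [eta' [te' e01' etaB]] := appB _ e20.
(* This is 1 - (1 - eta)(1 - eta'): it stays in [0, 1], and its distance to the indicator of the
   union is at most the sum of the two distances. *)
pose z x := eta x + (eta' x + (-1) * (eta x * eta' x)).
have tz : tensor z.
  apply: tensorD => //; apply: tensorD => //.
  by apply: tensorM; [exact: tensor_cst|exact: tensorM].
have z01 x : 0 <= z x <= 1.
  by rewrite /z; have /andP[? ?] := e01 x; have /andP[? ?] := e01' x; nra.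
exists z; split => //.
have uz := tensor_unit tz z01.
apply: (@le_trans _ _ (dist eta (\1_A) + dist eta' (\1_B))); last lra.
have ? := tensor_unit te e01; have ? := tensor_unit te' e01'.
have ? := indic_unit mA; have ? := indic_unit mB.
have ? := indic_unit (measurableU _ _ mA mB).
rewrite /dist -RintegralD//; try exact: dist_integrable.
apply: le_Rintegral => //; first exact: dist_integrable.
  by apply: integrable_add; exact: dist_integrable.
move=> x _; rewrite -mulrDr ler_wpM2l//.
rewrite /z !indicE in_setU; have /andP[? ?] := e01 x; have /andP[? ?] := e01' x.
have nA : `|eta x - 1| = 1 - eta x by rewrite ler0_norm; lra.
have nB : `|eta' x - 1| = 1 - eta' x by rewrite ler0_norm; lra.
have nA' : `|eta x - 0| = eta x by rewrite ger0_norm; lra.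
have nB' : `|eta' x - 0| = eta' x by rewrite ger0_norm; lra.
case: (x \in A); case: (x \in B) => /=;
  rewrite ?nA ?nB ?nA' ?nB' ler_norml; nra.
Qed.

Let approx0 : approx set0.
Proof.
split => // e e0; exists (fun=> 0); split; first exact: tensor0.
  by move=> x; rewrite lexx ler01.
rewrite /dist (_ : \int[mu]_x _ = 0) ?ltW//.
transitivity (\int[mu]_(x in [set: 'rV[R]_d]) (0 : R)).
  by apply: eq_Rintegral => x _; rewrite indicE in_set0 subr0 normr0 mulr0.
by rewrite Rintegral_cst// mul0r.
Qed.

Let approx_cvg (f_ : nat -> 'rV[R]_d -> R) f : (forall n, unit_valued (f_ n)) ->
  unit_valued f -> (forall x, f_ ^~ x @ \oo --> f x) ->
  forall e, 0 < e -> exists n, dist (f_ n) f <= e.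
Proof.
move=> uf_ uf ff e e0.
have mw : measurable_fun setT w.
  by apply/measurable_EFinP; exact: (measurable_int _ wi).
have [| | | |_] := @cvg_Rintegral _ _ _ mu
  (fun n x => `|w x| * `|f_ n x - f x|) (fun=> 0) (fun x => `|w x|).
- move=> n; have [? _] := uf_ n; have [? _] := uf.
  apply: measurable_funM; first exact: measurableT_comp.
  by apply: measurableT_comp => //; exact: measurable_funB.
- move=> x; rewrite -(mulr0 `|w x|); apply: cvgMr.
  have -> : (0 : R) = `|f x - f x| by rewrite subrr normr0.
  by apply: cvg_norm; apply: cvgB; [exact: ff|exact: cvg_cst].
- exact: (integrable_normr wi).
- move=> n x; rewrite normrM !normr_id -[leRHS]mulr1 ler_wpM2l// ler_norml.
  by have := (uf_ n).2 x; have := uf.2 x; lra.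
rewrite Rintegral_cst// mul0r => /cvgr0Pnorm_lt /(_ _ e0)[n _ /(_ n (leqnn n))].
by move=> /ltW nE; exists n; apply: le_trans nE; exact: ler_norm.
Qed.

Let approx_bigcup (F : (set 'rV[R]_d)^nat) :
  (forall n, approx (F n)) -> approx (\bigcup_n F n).
Proof.
move=> aF; have mF : measurable (\bigcup_n F n).
  by apply: bigcupT_measurable => n; have [] := aF n.
split => // e e0; have e20 : 0 < e / 2 by rewrite divr_gt0.
pose G n := \big[setU/set0]_(i < n) F i.
have aG n : approx (G n).
  rewrite /G; elim: n => [|n IH]; first by rewrite big_ord0.
  by rewrite big_ord_recr/=; exact: approxU.
have GF x : (fun n => \1_(G n) x : R) @ \oo --> (\1_(\bigcup_n F n) x : R).
  apply: cvg_near_cst.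
  have [[k _ Fkx]|nFx] := pselect ((\bigcup_n F n) x); last first.
    apply: nearW => n; rewrite !indicE !memNset// /G => + .
    by rewrite -bigcup_mkord => -[k _ Fkx]; apply: nFx; exists k.
  exists k.+1 => // n /= kn; rewrite !indicE !mem_set//; first by exists k.
  by rewrite /G -bigcup_mkord; exists k.
have uG n : unit_valued (\1_(G n)) by apply: indic_unit; have [] := aG n.
have [n Gn] := approx_cvg uG (indic_unit mF) GF e20.
have [eta [te e01 etaG]] := (aG n).2 _ e20.
exists eta; split => //.
apply: le_trans (distD (tensor_unit te e01) (uG n) (indic_unit mF)) _.
lra.
Qed.

Let approx_sigma_algebra : sigma_algebra setT approx.
Proof.
by split => // A aA; rewrite setTD; exact: approxC.
Qed.

Let approx_halfspace (i : 'I_d) (t : R) :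
  approx (@rV_coord R d i @^-1` `]t, +oo[).
Proof.
have mA : measurable (@rV_coord R d i @^-1` `]t, +oo[).
  by rewrite -[X in measurable X]setTI; exact: measurable_rV_coord.
split => // e e0; have [S [sS S0 S1 S01]] := @smooth1_step R.
(* Zero for x_i <= t and 1 as soon as n >= 1/(x_i - t): the convergence to the indicator holds at
   every point, the boundary included, because the half-space is open. *)
pose f_ n (x : 'rV[R]_d) := S (n%:R * x 0 i + - (n%:R * t)).
have tf n : tensor (f_ n).
  apply: (@tensor_coord _ _ i (fun y => S (n%:R * y + - (n%:R * t)))).
  exact: smooth1_affine.
have uf n : unit_valued (f_ n) by apply: tensor_unit => // x; exact: S01.
have [|n fn] := approx_cvg uf (indic_unit mA) _ e0.
  move=> x; apply: cvg_near_cst; rewrite indicE.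
  have [tx|xt] := ltP t (x 0 i); last first.
    apply: nearW => n; rewrite memNset; last first.
      by rewrite /= in_itv/= andbT /rV_coord => /lt_geF; rewrite xt.
    by rewrite /f_ S0// -mulrBr mulr_ge0_le0// subr_le0.
  have xt0 : 0 < (x 0 i - t)^-1 by rewrite invr_gt0 subr_gt0.
  near=> n; rewrite mem_set/=; last by rewrite in_itv/= andbT.
  rewrite /f_ S1// -mulrBr -ler_pdivrMr ?subr_gt0// div1r.
  by near: n; exact: nbhs_infty_ger.
by exists (f_ n); split => // x; exact: S01.
Unshelve. all: by end_near. Qed.

(** Two nested generation arguments: coordinate preimages generate the measurable sets of R^d, and
    open rays generate those of the line. *)
Lemma tensor_approx_indic A (e : R) : measurable A -> 0 < e ->
  exists eta, [/\ tensor eta, forall x, 0 <= eta x <= 1 &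
    \int[mu]_x (`|w x| * `|eta x - \1_A x|) <= e].
Proof.
move=> mA e0; suff [_ /(_ e e0)] : approx A by [].
move: A mA; apply: smallest_sub; first exact: approx_sigma_algebra.
move=> B; rewrite -bigcup_seq/= => -[i _ [C mC <-]]; rewrite setTI.
move: C mC; rewrite RGenOInfty.measurableE; apply: smallest_sub.
  split.
  - by rewrite preimage_set0.
  - by move=> C aC; rewrite setTD preimage_setC; exact: approxC.
  - by move=> F aF; rewrite preimage_bigcup; exact: approx_bigcup.
by move=> _ [t ->]; exact: approx_halfspace.
Qed.

End indicator.

Definition open_box (b c : 'rV[R]_d) : set 'rV[R]_d :=
  [set x | forall i, b 0 i < x 0 i < c 0 i].

Lemma measurable_open_box b c : measurable (open_box b c).
Proof.
rewrite [X in measurable X](_ : _ = \bigcap_(i in [set: 'I_d])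
  (rV_coord i @^-1` `]b 0 i, c 0 i[%classic)); last first.
  apply/seteqP; split => x h i.
    by move=> _; have := h i; rewrite /= in_itv.
  by have := h i I; rewrite /= in_itv.
apply: fin_bigcap_measurable => // i _.
by rewrite -[X in measurable X]setTI; exact: measurable_rV_coord.
Qed.

(** In each coordinate, a step rising from [b 0 i] times a step falling to [c 0 i], both steepening
    with n. Vanishing exactly off the box is what will confine the supports of test fields. *)
Lemma tensor_cutoff (b c : 'rV[R]_d) : exists theta : nat -> 'rV[R]_d -> R,
  [/\ forall n, tensor (theta n), forall n x, 0 <= theta n x <= 1,
      forall n x, ~ open_box b c x -> theta n x = 0 &
      forall x, open_box b c x -> theta ^~ x @ \oo --> (1 : R)].
Proof.
have [S [sS S0 S1 S01]] := @smooth1_step R.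
exists (fun n x => \prod_i (S (n%:R * x 0 i + - (n%:R * b 0 i)) *
  S ((- n%:R) * x 0 i + n%:R * c 0 i))); split.
- move=> n;
  apply: (@tensor_prod _ _ (fun i y => S (n%:R * y + - (n%:R * b 0 i)) *
    S ((- n%:R) * y + n%:R * c 0 i))) => i.
  by apply: smooth1M; exact: smooth1_affine.
- move=> n x; apply/andP; split.
    apply: prodr_ge0 => i _; apply: mulr_ge0.
      by have /andP[] := S01 (n%:R * x 0 i + - (n%:R * b 0 i)).
    by have /andP[] := S01 (- n%:R * x 0 i + n%:R * c 0 i).
  apply: prodr_ile1 => i _.
  have /andP[p1 p2] := S01 (n%:R * x 0 i + - (n%:R * b 0 i)).
  have /andP[q1 q2] := S01 (- n%:R * x 0 i + n%:R * c 0 i).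
  by rewrite mulr_ge0//= mulr_ile1.
- move=> n x /existsNP[i /negP]; rewrite negb_and -!leNgt => xi.
  rewrite (bigD1 i)//=; case/orP: xi => xi.
    by rewrite S0 ?mul0r// -mulrBr mulr_ge0_le0// subr_le0.
  rewrite (S0 (_ * _ + _ * _)) ?mulr0 ?mul0r//.
  by rewrite mulNr addrC -mulrBr mulr_ge0_le0// subr_le0.
- move=> x bx; apply: cvg_near_cst.
  have : \forall n \near \oo, forall i : 'I_d,
     (x 0 i - b 0 i)^-1 <= n%:R /\ (c 0 i - x 0 i)^-1 <= n%:R.
    apply: filter_forall => i; near=> n; split; near: n; exact: nbhs_infty_ger.
  apply: filterS => n nP; rewrite big1// => i _.
  have /andP[bxi xci] := bx i; have [n1 n2] := nP i.
  rewrite !S1 ?mulr1//.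
    by rewrite mulNr addrC -mulrBr -ler_pdivrMr ?subr_gt0// div1r.
  by rewrite -mulrBr -ler_pdivrMr ?subr_gt0// div1r.
Unshelve. all: by end_near. Qed.

(* With A = [w > 0], the function theta (2 eta_A - 1) is close to the sign of
   w. *)
Lemma tensor_approx_sign w (b c : 'rV[R]_d) (e : R) :
  mu.-integrable setT (EFin \o w) -> (forall x, ~ open_box b c x -> w x = 0) ->
  0 < e ->
  exists eta, [/\ tensor eta, forall x, `|eta x| <= 1,
    forall x, ~ open_box b c x -> eta x = 0 &
    \int[mu]_x `|w x| - e <= \int[mu]_x (w x * eta x)].
Proof.
(* The cutoff costs e/2; the indicator costs twice e/4, as 2 eta - 1 doubles its error. *)
move=> wi w0 e0; have e40 : 0 < e / 4 by rewrite divr_gt0.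
have e20 : 0 < e / 2 by rewrite divr_gt0.
have mw : measurable_fun setT w by apply/measurable_EFinP;
  exact: (measurable_int _ wi).
pose A := [set x | 0 < w x].
have mA : measurable A.
  rewrite (_ : A = w @^-1` `]0, +oo[);
    first by rewrite -[X in measurable X]setTI; exact: mw.
  by apply/seteqP; split => x; rewrite /A/= in_itv/= andbT.
have [eta [te e01 etaA]] := tensor_approx_indic wi mA e40.
have [theta [tt t01 t0 t1]] := tensor_cutoff b c.
have wn := integrable_normr wi.
have [| | | |_ /cvgrPdist_lt /(_ _ e20)[n _ /(_ n (leqnn n))]] :=
    @cvg_Rintegral _ _ _ mu (fun n x => `|w x| * theta n x)
    (fun x => `|w x|) (fun x => `|w x|).
- move=> n; apply: measurable_funM; first exact: measurableT_comp.
  exact: tensor_measurable.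
- move=> x; have [bx|nbx] := pselect (open_box b c x); last first.
    by rewrite w0// normr0; under eq_fun do rewrite mul0r; exact: cvg_cst.
  by rewrite -[X in _ --> X]mulr1; apply: cvgMr; exact: t1.
- exact: wn.
- move=> n x; rewrite normrM normr_id -[leRHS]mulr1 ler_wpM2l//.
  by have /andP[? ?] := t01 n x; rewrite ger0_norm.
move=> tE.
have ti : mu.-integrable setT (fun x => (`|w x| * theta n x)%:E).
  apply: (@integrable_bounded_mul _ _ _ _ _ _ 1) => //.
    exact: tensor_measurable.
  by move=> x; have /andP[? ?] := t01 n x; rewrite ger0_norm.
exists (fun x => theta n x * (2 * eta x + -1)); split.
- apply: tensorM => //; apply: tensorD; last exact: tensor_cst.
  by apply: tensorM => //; exact: tensor_cst.
- move=> x; rewrite normrM; apply: mulr_ile1 => //.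
    by have /andP[? ?] := t01 n x; rewrite ger0_norm.
  by rewrite ler_norml; have /andP[? ?] := e01 x; lra.
- by move=> x nbx; rewrite t0// mul0r.
have ei : mu.-integrable setT (fun x => (`|w x| * `|eta x - \1_A x|)%:E).
  apply: (@integrable_bounded_mul _ _ _ _ _ _ 1) => //.
    apply: measurableT_comp => //; apply: measurable_funB => //.
    exact: tensor_measurable.
  move=> x; rewrite normr_id ler_norml indicE; have /andP[? ?] := e01 x.
  by case: (x \in A) => /=; lra.
have ei2 : mu.-integrable setT
  (fun x => ((- 2) * (`|w x| * `|eta x - \1_A x|))%:E).
  exact: (integrableZl measurableT (-2) ei).
have fi : mu.-integrable setT
  (fun x => (w x * (theta n x * (2 * eta x + -1)))%:E).
  apply: (@integrable_bounded_mul _ _ _ _ _ _ 1) => //.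
    apply: measurable_funM; first exact: tensor_measurable.
    apply: measurable_funD => //; apply: measurable_funM => //.
    exact: tensor_measurable.
  move=> x; rewrite normrM; apply: mulr_ile1 => //.
    by have /andP[? ?] := t01 n x; rewrite ger0_norm.
  by rewrite ler_norml; have /andP[? ?] := e01 x; lra.
(* Pointwise, w theta (2 eta - 1) = |w| theta (1 - 2 |eta - 1_A|), and theta <= 1. *)
have le1 : \int[mu]_x
  (`|w x| * theta n x + - 2 * (`|w x| * `|eta x - \1_A x|)) <=
   \int[mu]_x (w x * (theta n x * (2 * eta x + -1))).
  apply: le_Rintegral => //; first exact: integrable_add.
  move=> x _; have /andP[? ?] := e01 x; have /andP[? ?] := t01 n x.
  rewrite indicE; have [w0x|w0x] := ltP 0 (w x).
    rewrite mem_set// gtr0_norm//= ler0_norm; last lra.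
    have : 0 <= w x * ((1 - theta n x) * (1 - eta x)).
      by rewrite mulr_ge0 ?(ltW w0x)// mulr_ge0 ?subr_ge0.
    nra.
  rewrite memNset/=; last by rewrite /A/=; lra.
  rewrite ler0_norm// ger0_norm; last lra.
  have : 0 <= (- w x) * ((1 - theta n x) * eta x).
    by rewrite mulr_ge0 ?oppr_ge0// mulr_ge0 ?subr_ge0.
  nra.
have le2 : \int[mu]_x (`|w x| * theta n x + - 2 * (`|w x| * `|eta x - \1_A x|))
  =
   \int[mu]_x (`|w x| * theta n x) - 2 * \int[mu]_x
     (`|w x| * `|eta x - \1_A x|).
  by rewrite RintegralD// RintegralZl// mulNr.
move: tE; rewrite ltr_norml => /andP[_]; lra.
Qed.

End approximation.

(** * Difference quotients and total variation *)

Section integral_sums.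
Context {dT : measure_display} {T : measurableType dT} {R : realType}.
Variable mu : {measure set T -> \bar R}.

Lemma integrable_scale (k : R) (w : T -> R) :
  mu.-integrable setT (fun x => (w x)%:E) ->
  mu.-integrable setT (fun x => (k * w x)%:E).
Proof. by move=> wi; apply: eq_integrable (integrableZl _ k wi). Qed.

Lemma integrable_sub (w b : T -> R) :
  mu.-integrable setT (fun x => (w x)%:E) ->
  mu.-integrable setT (fun x => (b x)%:E) ->
  mu.-integrable setT (fun x => (w x - b x)%:E).
Proof. by move=> wi bi; apply: eq_integrable (integrableB _ wi bi). Qed.

Lemma Rintegral_sum (I : Type) (s : seq I) (f : I -> T -> R) :
  (forall i, mu.-integrable setT (fun x => (f i x)%:E)) ->
  mu.-integrable setT (fun x => (\sum_(i <- s) f i x)%:E) /\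
  \int[mu]_x (\sum_(i <- s) f i x) = \sum_(i <- s) \int[mu]_x f i x.
Proof.
move=> fi; elim: s => [|i s [IHi IH]].
  under eq_fun do rewrite big_nil.
  split; first exact: integrable0.
  under eq_Rintegral do rewrite big_nil.
  by rewrite Rintegral_cst// mul0r big_nil.
under eq_fun do rewrite big_cons.
split; first exact: integrable_add.
under eq_Rintegral do rewrite big_cons.
by rewrite RintegralD//; [rewrite IH big_cons|exact: fi].
Qed.

End integral_sums.

(** * Derivatives along lines and the maximum norm *)

Section lines.
Context {R : realType} {d : nat}.

Lemma is_derive_along (F dF : 'rV[R]_d -> R) (v y : 'rV[R]_d) (t : R) :
  (forall x, is_derive x v F (dF x)) ->
  is_derive t 1 (fun s : R => F (s *: v + y)) (dF (t *: v + y)).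
Proof.
move=> FdF; have [Fd <-] := FdF (t *: v + y).
have E :
  (fun h : R => h^-1 *: ((F \o shift (t *: v + y)) (h *: v) - F (t *: v + y))) =
  (fun h : R => h^-1 *: (((fun s : R => F (s *: v + y)) \o shift t)
    (h *: (1 : R))
     - F (t *: v + y))).
  by apply/funext => h /=; rewrite [h *: 1]mulr1 scalerDl addrA.
by split; [move: Fd; rewrite /derivable E|rewrite /derive E].
Qed.

Lemma mean_value_line (F dF : 'rV[R]_d -> R) (v y : 'rV[R]_d) (h : R) :
  (forall x, is_derive x v F (dF x)) -> 0 <= h ->
  exists2 s, 0 <= s <= h & F (h *: v + y) - F y = dF (s *: v + y) * h.
Proof.
move=> FdF h0.
have [s sh E] := mean_value h0 (fun t => is_derive_along y t FdF).
by exists s => //; rewrite -[h in RHS]subr0 -E scale0r add0r.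
Qed.

Lemma rV_norm_le (x : 'rV[R]_d) (c : R) : 0 <= c -> (forall i, `|x 0 i| <= c) ->
  `|x| <= c.
Proof.
move=> c0 xc; rewrite [`|x|]mx_normrE; apply: bigmax_le => // -[i j] _ /=.
by rewrite ord1.
Qed.

Lemma rV_coord_le_norm (x : 'rV[R]_d) (i : 'I_d) : `|x 0 i| <= `|x|.
Proof.
rewrite [`|x|]mx_normrE.
exact: (le_bigmax 0 (fun ij : 'I_1 * 'I_d => `|x ij.1 ij.2|) (0, i)).
Qed.

End lines.

(** * Difference quotients bounded by the total variation *)

Section difference_quotients.
Context {R : realType} {d : nat}.
Notation mu := (lebesgue_rV R d).
Implicit Types (f u : 'rV[R]_d -> R) (a l x v : 'rV[R]_d).

(** Translation invariance moves the shift from [eta] to [f]; integrating over the whole space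
    leaves no boundary term. *)
Lemma summation_by_parts f (eta : 'rV[R]_d -> R) v (M : R) :
  mu.-integrable setT (EFin \o f) -> measurable_fun setT eta ->
  (forall x, `|eta x| <= M) ->
  \int[mu]_x (f x * (eta x - eta (x - v))) =
  \int[mu]_x ((f x - f (x + v)) * eta x).
Proof.
move=> fi me eM.
have fei : mu.-integrable setT (fun x => (f x * eta x)%:E).
  exact: integrable_bounded_mul eM.
have fei' : mu.-integrable setT (fun x => (f x * eta (x - v))%:E).
  apply: (@integrable_bounded_mul _ _ _ _ _ _ M) => //.
  exact: measurableT_comp me (measurable_rV_shift (- v)).
have fei2 : mu.-integrable setT (fun x => (f (x + v) * eta x)%:E).
  apply: (@integrable_bounded_mul _ _ _ _ _ _ M) => //.
  exact: (integrable_shift v fi).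
under eq_Rintegral do rewrite mulrBr.
under [RHS]eq_Rintegral do rewrite mulrBl.
rewrite !RintegralB//; congr (_ - _).
rewrite -(Rintegral_shift v fei').
by apply: eq_Rintegral => x _; rewrite addrK.
Qed.

Lemma integral_restrict (D : set 'rV[R]_d) u (g : 'rV[R]_d -> R) :
  mu.-integrable setT (fun x => ((u \_ D) x * g x)%:E) ->
  (\int[mu]_(x in D) (u x * g x)%:E)%E =
  (\int[mu]_x ((u \_ D) x * g x))%:E.
Proof.
move=> ui; rewrite /Rintegral fineK; last exact: integrable_fin_num ui.
rewrite [LHS]integral_mkcond; apply: eq_integral => x _.
by rewrite !patchE; case: ifP => //; rewrite mul0r.
Qed.

(** The margin keeps x + s e_i in the hyperrectangle for x in the inner box and 0 <= s < delta, so
    that the jump of the extension by zero across the boundary never enters a difference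
    quotient. *)
Definition inner_box a l (delta : R) : set 'rV[R]_d :=
  open_box (\row_i (a 0 i + delta)) (\row_i (a 0 i + l 0 i - delta)).

Lemma inner_boxP a l (delta : R) x : inner_box a l delta x <->
  forall i, a 0 i + delta < x 0 i < a 0 i + l 0 i - delta.
Proof. by split => h i; have := h i; rewrite !mxE. Qed.

Lemma measurable_inner_box a l (delta : R) : measurable (inner_box a l delta).
Proof. exact: measurable_open_box. Qed.

(* Testing against H_i(x) = h^-1 int_0^h eta_i(x - s e_i) ds, with eta_i close
   to the sign of the difference quotient: by the mean value theorem H_i is
   bounded by 1 and supported in Omega. *)
Lemma difference_quotient_le_TV (i0 : 'I_d) a l u (delta h : R) :
  0 < h -> h < delta ->
  mu.-integrable setT (EFin \o (u \_ (hyperrectangle a l))) ->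
  ((\sum_i h^-1 * \int[mu]_x
     `|((u \_ (hyperrectangle a l)) x -
        (u \_ (hyperrectangle a l)) (x + h *: delta_mx 0 i)) *
        \1_(inner_box a l delta) x|)%:E
   <= anisotropic_TV (hyperrectangle a l) u)%E.
Proof.
set Omega := hyperrectangle a l; set U := u \_ Omega;
  set E := inner_box a l delta.
move=> h0 hd Ui.
pose e (i : 'I_d) : 'rV[R]_d := delta_mx 0 i.
pose w (i : 'I_d) x := (U x - U (x + h *: e i)) * \1_E x.
have mE : measurable E by exact: measurable_inner_box.
have Udi i : mu.-integrable setT (fun x => (U x - U (x + h *: e i))%:E).
  by apply: integrable_sub => //; exact: (integrable_shift _ Ui).
have wi i : mu.-integrable setT (EFin \o w i).
  apply: (@integrable_bounded_mul _ _ _ _ _ _ 1) => //; first exact: Udi.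
  by move=> x; rewrite indicE; case: (x \in E); rewrite ?normr1 ?normr0 ?ler01.
apply/lee_addgt0Pr => eps eps0.
have d0 : (0 < d)%N by case: (d) i0 => // -[].
(* Each of the d coordinates loses [h^-1 * eps'], in total [eps]. *)
pose eps' := eps * h / d%:R.
have eps'0 : 0 < eps' by rewrite !mulr_gt0// invr_gt0 ltr0n.
have /choice[eta etaP] (i : 'I_d) : exists eta : 'rV[R]_d -> R,
    [/\ tensor eta, forall x, `|eta x| <= 1, forall x, ~ E x -> eta x = 0 &
    \int[mu]_x `|w i x| - eps' <= \int[mu]_x (w i x * eta x)].
  apply: tensor_approx_sign => // x nEx.
  by rewrite /w indicE memNset// mulr0.
have /choice[Q QP] (i : 'I_d) : exists Q : 'rV[R]_d -> R,
    tensor Q /\ forall x, is_derive x (e i) Q (eta i x).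
  have [te _ _ _] := etaP i.
  by have [Q ? ?] := tensor_antiderivative i te; exists Q.
pose Hc i x := h^-1 * (Q i x + (-1) * Q i (x + (- h *: e i))).
pose H x : 'rV[R]_d := \row_i Hc i x.
have tHc i : tensor (Hc i).
  apply: tensorM; first exact: tensor_cst.
  apply: tensorD; first by have [] := QP i.
  apply: tensorM; first exact: tensor_cst.
  by apply: tensor_shift; have [] := QP i.
have HcE i x : exists2 s, 0 <= s <= h & Hc i x = eta i (x - s *: e i).
  have [s /andP[s0 sh]] := mean_value_line (x + (- h *: e i)) (QP i).2 (ltW h0).
  rewrite [h *: _ + _]addrC scaleNr subrK => QE.
  exists (h - s); first by rewrite subr_ge0 sh/= gerBl.
  rewrite /Hc mulN1r scaleNr QE mulrCA mulVf ?gt_eqF// mulr1.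
  by congr (eta i _); rewrite scalerBl opprB addrCA.
have HcE' i x : is_derive x (e i) (Hc i)
  (h^-1 * (eta i x - eta i (x - h *: e i))).
  have [_ Qd] := QP i.
  have Qd' : is_derive x (e i) (fun y => Q i (y + (- h *: e i)))
    (eta i (x - h *: e i)).
    rewrite -scaleNr.
    apply: (@is_derive_line _ _ _
      (fun t : R => Q i (t *: e i + (x + (- h *: e i)))) _ _ 0).
      by move=> t; rewrite addr0 addrA.
    have := is_derive_along (x + (- h *: e i)) 0 Qd.
    by rewrite scale0r add0r.
  have QN : is_derive x (e i) (fun y => (-1) * Q i (y + (- h *: e i)))
      ((-1) * eta i (x - h *: e i)) by exact: is_deriveZ.
  rewrite -[X in _ * (_ + X)]mulN1r.
  have QD := is_deriveD (Qd x) QN.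
  exact: is_deriveZ QD.
(* The divergence is exactly a sum of backward difference quotients, which summation by parts then
   transfers to [U]. *)
have divE x : divergence H x = \sum_i h^-1 * (eta i x - eta i (x - h *: e i)).
  apply: eq_bigr => i _; rewrite /partial.
  rewrite (_ : (fun y => H y 0 i) = Hc i); last by apply/funext => y;
    rewrite mxE.
  by have dH := HcE' i x; rewrite derive_val.
(* [H] at x is made of values of the [eta j] at x - s e_j with 0 <= s <= h, so its support exceeds
   [E] by at most h, on the upper side only; the closed box [K] lies in [Omega] because h <
   delta. *)
pose K : set 'rV[R]_d := [set x | forall i,
  `[a 0 i + delta, a 0 i + l 0 i - delta + h]%classic (x 0 i)].
have cK : compact K.
  apply: (@rV_compact R d (fun i =>
    `[a 0 i + delta, a 0 i + l 0 i - delta + h]%classic)) => i.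
  exact: segment_compact.
have sHK : closed_support H `<=` K.
  rewrite /closed_support.
  have clK : closed K by apply: compact_closed => //; exact: norm_hausdorff.
  rewrite (closure_id K).1//; apply: closure_subset => x /= Hx i.
  have [j Hcj] : exists j, Hc j x != 0.
    apply: contrapT => /forallNP Hc0; move/eqP: Hx; apply.
    by apply/rowP => j; rewrite !mxE; apply/eqP; have /negP := Hc0 j;
      rewrite negbK.
  have [s /andP[s0 sh] HsE] := HcE j x.
  have : E (x - s *: e j).
    apply: contrapT => nE; move: Hcj; rewrite HsE.
    by have [_ _ -> //] := etaP j; rewrite eqxx.
  move=> /inner_boxP /(_ i); rewrite !mxE eqxx/= in_itv/=.
  by case: (i == j); rewrite ?mulr1 ?mulr0; lra.
have KO : K `<=` Omega.
  by move=> x Kx i; have := Kx i; rewrite /= in_itv/=; lra.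
have testH : test_field Omega H.
  split.
  - move=> i; rewrite (_ : (fun y => H y 0 i) = Hc i);
    last by apply/funext => y; rewrite mxE.
    exact: tensor_smooth.
  - apply: subclosed_compact cK sHK; exact: closed_closure.
  - exact: subset_trans sHK KO.
  - move=> x _; apply: rV_norm_le => // i; rewrite mxE.
    by have [s _ ->] := HcE i x; have [_ + _ _] := etaP i; apply.
have meta i : measurable_fun setT (eta i).
  by have [te _ _ _] := etaP i; exact: tensor_measurable.
have Uei i : mu.-integrable setT
    (fun x => (U x * (h^-1 * (eta i x - eta i (x - h *: e i))))%:E).
  apply: (@integrable_bounded_mul _ _ _ _ _ _ (h^-1 * 2)) => //.
    apply: measurable_funM => //; apply: measurable_funB => //.
    exact: measurableT_comp (meta i) (measurable_rV_shift (- _)).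
  move=> x; rewrite normrM gtr0_norm ?invr_gt0// ler_wpM2l ?invr_ge0
    ?(ltW h0)//.
  apply: le_trans (ler_normB _ _) _.
  by have [_ e1 _ _] := etaP i; rewrite lerD.
have [sumi sumE] := Rintegral_sum (index_enum 'I_d) Uei.
apply: (@le_trans _ _ ((\int[mu]_x (U x * divergence H x) + eps)%:E));
  last first.
  rewrite EFinD leeD2r//; apply: ereal_sup_ubound; exists H => //.
  apply: integral_restrict; apply: eq_integrable sumi => // x _.
  by rewrite divE mulr_sumr.
rewrite lee_fin.
under [X in _ <= X + _]eq_Rintegral do rewrite divE mulr_sumr.
rewrite sumE.
have -> : eps = \sum_(i < d) h^-1 * eps'.
  rewrite sumr_const card_ord -mulr_natr /eps' mulrC.
  have dn0 : d%:R != 0 :> R by rewrite pnatr_eq0 -lt0n.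
  have hn0 : h != 0 by rewrite gt_eqF.
  by field; rewrite dn0 hn0.
rewrite -big_split/=; apply: ler_sum => i _.
have [te e1 e0 etaw] := etaP i.
have -> : \int[mu]_x (U x * (h^-1 * (eta i x - eta i (x - h *: e i)))) =
    h^-1 * \int[mu]_x (w i x * eta i x).
  under eq_Rintegral do rewrite mulrCA.
  rewrite RintegralZl//; last first.
    apply: (@integrable_bounded_mul _ _ _ _ _ _ 2) => //.
      apply: measurable_funB => //.
      exact: measurableT_comp (meta i) (measurable_rV_shift (- _)).
    by move=> x; apply: le_trans (ler_normB _ _) _; rewrite lerD.
  (* The factor [\1_E] in [w i] changes nothing here, since [eta i] vanishes off [E]. *)
  congr (_ * _); rewrite (summation_by_parts _ Ui (meta i) e1).
  apply: eq_Rintegral => x _; rewrite /w indicE.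
  have [Ex|nEx] := pselect (E x); first by rewrite mem_set// mulr1.
  by rewrite e0// !mulr0.
rewrite -mulrDr ler_wpM2l// ?invr_ge0 ?(ltW h0)//.
by rewrite -lerBlDr.
Qed.

End difference_quotients.

Lemma cvgn_sum {R : realType} (I : Type) (s : seq I) (F : I -> nat -> R)
    (L : I -> R) : (forall i, F i @ \oo --> L i) ->
  (fun n => \sum_(i <- s) F i n) @ \oo --> \sum_(i <- s) L i.
Proof.
move=> FL; elim: s => [|i s IH].
  by rewrite big_nil; under eq_fun do rewrite big_nil; exact: cvg_cst.
by rewrite big_cons; under eq_fun do rewrite big_cons; exact: cvgD.
Qed.

(** * Test fields and the splitting of the total variation *)

Section test_fields.
Context {R : realType} {d : nat}.
Notation mu := (lebesgue_rV R d).
Implicit Types (u v g : 'rV[R]_d -> R) (a l x : 'rV[R]_d)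
  (H : 'rV[R]_d -> 'rV[R]_d).

(** Each coordinate attains its extrema on a nonempty compact support, at points of the open box;
    this leaves a positive margin in each of finitely many directions. *)
Lemma test_field_inner a l H : test_field (hyperrectangle a l) H ->
  \forall delta \near 0^'+, closed_support H `<=` inner_box a l delta.
Proof.
case=> _ cK KO _; set K := closed_support H in cK KO *.
have [K0|/set0P K0] := eqVneq K set0; first by apply: nearW => e; rewrite K0.
have : \forall delta \near (0 : R)^'+, forall i : 'I_d, forall x, K x ->
    a 0 i + delta < x 0 i < a 0 i + l 0 i - delta.
  apply: filter_forall => i.
  have cc : {within K, continuous (fun x : 'rV[R]_d => x 0 i)}.
    by apply: continuous_subspaceT; exact: coord_continuous.
  have [p pK pE] := EVT_min_rV K0 cK cc.
  have [q qK qE] := EVT_max_rV K0 cK cc.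
  have /andP[p1 _] := KO p (set_mem pK) i.
  have /andP[_ q1] := KO q (set_mem qK) i.
  near=> delta => x Kx.
  have d1 : delta < p 0 i - a 0 i.
    by near: delta; apply: nbhs_right_lt; rewrite subr_gt0.
  have d2 : delta < a 0 i + l 0 i - q 0 i.
    by near: delta; apply: nbhs_right_lt; rewrite subr_gt0.
  by have := pE x (mem_set Kx); have := qE x (mem_set Kx); lra.
by apply: filterS => delta dP x Kx; apply/inner_boxP => i; exact: dP.
Unshelve. all: by end_near. Qed.

Lemma not_closed_support H x : ~ closed_support H x -> H x = 0.
Proof.
by move=> nx; apply: contrapT => /eqP Hx; apply: nx; exact: subset_closure.
Qed.

Lemma test_field_is_derive (Om : set 'rV[R]_d) H i x : test_field Om H ->
  is_derive x (delta_mx 0 i) (fun y => H y 0 i)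
    (partial i (fun y => H y 0 i) x).
Proof.
by case=> sH _ _ _; apply: derivableP; have [_] := sH i [::]; apply.
Qed.

Lemma test_field_coord_continuous (Om : set 'rV[R]_d) H i : test_field Om H ->
  continuous (fun y => H y 0 i).
Proof. by case=> sH _ _ _; have [] := sH i [::]. Qed.

Lemma test_field_partial_continuous (Om : set 'rV[R]_d) H i : test_field Om H ->
  continuous (partial i (fun y => H y 0 i)).
Proof. by case=> sH _ _ _; have [] := sH i [:: i]. Qed.

(** The partial derivative is continuous on the compact support, and zero off it because the
    component vanishes on an open set there. The bound will dominate the difference quotients of
    [H]. *)
Lemma test_field_partial_bounded (Om : set 'rV[R]_d) H i : test_field Om H ->
  exists M, forall x, `|partial i (fun y => H y 0 i) x| <= M.
Proof.
move=> tH; have [_ cK _ _] := tH; set K := closed_support H in cK *.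
have out x : ~ K x -> partial i (fun y => H y 0 i) x = 0.
  move=> nKx; have nxK : nbhs x (~` K).
    by apply: open_nbhs_nbhs; split => //; exact/closed_openC/closed_closure.
  have H0 : \near x, H x 0 i = 0.
    by apply: filterS nxK => y nKy; rewrite not_closed_support ?mxE.
  by rewrite /partial (near_eq_derive (g := fun=> 0) _ H0) derive_cst.
have [K0|/set0P K0] := eqVneq K set0.
  by exists 0 => x; rewrite out ?normr0// K0.
have cc : {within K, continuous (fun x => `|partial i (fun y => H y 0 i) x|)}.
  apply: continuous_subspaceT => x.
  have cP := test_field_partial_continuous (i := i) tH.
  exact: (cvg_norm (cP x)).
have [p pK pE] := EVT_max_rV K0 cK cc.
exists `|partial i (fun y => H y 0 i) p| => x.
have [Kx|nKx] := pselect (K x); first exact/pE/mem_set.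
by rewrite out// normr0.
Qed.

Lemma test_field_coord_le1 (Om : set 'rV[R]_d) H i x : test_field Om H ->
  `|H x 0 i| <= 1.
Proof.
move=> [_ _ KO H1]; apply: le_trans (rV_coord_le_norm _ _) _.
have [Ox|nOx] := pselect (Om x); first exact: H1.
by rewrite not_closed_support ?normr0// => /KO.
Qed.

Lemma cvg_difference_quotient (F : 'rV[R]_d -> R) (v x : 'rV[R]_d)
  (h : nat -> R)
    (df : R) : is_derive x v F df -> (forall n, 0 < h n) -> h @ \oo --> 0 ->
  (h n)^-1 * (F x - F (x - h n *: v)) @[n --> \oo] --> df.
Proof.
move=> [Fd <-] h0 hc.
have hN : (- h n) @[n --> \oo] --> (0 : R)^'.
  have hN0 : (- h n) @[n --> \oo] --> (0 : R) by rewrite -oppr0; exact: cvgN.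
  move=> A [e /= e0 eA]; have [N _ NP] := hN0 (ball 0 e) (nbhsx_ballx _ e e0).
  exists N => // n /= Nn; apply: eA => /=; first exact: (NP n Nn).
  by rewrite oppr_eq0 gt_eqF.
rewrite (_ : (fun n => _) =
  (fun k : R => k^-1 *: ((F \o shift x) (k *: v) - F x)) \o (fun n => - h n)).
  exact: cvg_comp hN Fd.
apply/funext => n /=; rewrite invrN !scaleNr -scalerN opprB.
by rewrite [- _ + x]addrC.
Qed.

Section split.
Variables (i0 : 'I_d) (a l : 'rV[R]_d).
Let Omega := hyperrectangle a l.

(** Summation by parts puts the differences on [H], where the quotients converge pointwise to the
    partial derivatives and are bounded through the mean value theorem; M |V| dominates. *)
Lemma cvg_integral_divergence v H (h : nat -> R) : test_field Omega H ->
  mu.-integrable setT (EFin \o (v \_ Omega)) ->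
  (forall n, 0 < h n) -> h @ \oo --> 0 ->
  mu.-integrable setT (fun x => ((v \_ Omega) x * divergence H x)%:E) /\
  (\sum_i (h n)^-1 * \int[mu]_x
     (((v \_ Omega) x - (v \_ Omega) (x + h n *: delta_mx 0 i)) * H x 0 i))
    @[n --> \oo] --> \int[mu]_x ((v \_ Omega) x * divergence H x).
Proof.
move=> tH Vi h0 hc; set V := v \_ Omega in Vi *.
pose P i := partial i (fun y => H y 0 i).
have mH i : measurable_fun setT (fun y => H y 0 i).
  apply: continuous_measurable_rV;
    exact: (test_field_coord_continuous (i := i) tH).
have mP i : measurable_fun setT (P i).
  apply: continuous_measurable_rV;
    exact: (test_field_partial_continuous (i := i) tH).
have VPi i : mu.-integrable setT (fun x => (V x * P i x)%:E).
  have [M PM] := test_field_partial_bounded i tH.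
  exact: integrable_bounded_mul Vi (mP i) PM.
have [sumi sumE] := Rintegral_sum (index_enum 'I_d) VPi.
have divE x : V x * divergence H x = \sum_i V x * P i x by rewrite mulr_sumr.
split; first by apply: eq_integrable sumi => // x _; rewrite divE.
under [X in _ --> X]eq_Rintegral do rewrite divE.
rewrite sumE; apply: cvgn_sum => i.
have [M PM] := test_field_partial_bounded i tH.
have dH x := @test_field_is_derive _ _ i x tH.
pose q n x := (h n)^-1 * (H x 0 i - H (x - h n *: delta_mx 0 i) 0 i).
have qM n x : `|q n x| <= M.
  have [s _] := mean_value_line (x - h n *: delta_mx 0 i) dH (ltW (h0 n)).
  rewrite [h n *: _ + _]addrC subrK => E.
  by rewrite /q E mulrCA mulVf ?gt_eqF// mulr1.
have mq n : measurable_fun setT (q n).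
  apply: measurable_funM => //; apply: measurable_funB => //.
  exact: measurableT_comp (mH i) (measurable_rV_shift (- _)).
have E n : (h n)^-1 * \int[mu]_x ((V x - V (x + h n *: delta_mx 0 i)) * H x 0 i)
  =
    \int[mu]_x (V x * q n x).
  have H1 x : `|H x 0 i| <= 1 by exact: (test_field_coord_le1 _ _ tH).
  rewrite -(summation_by_parts _ Vi (mH i) H1) -RintegralZl//.
    by apply: eq_Rintegral => x _; rewrite /q mulrCA.
  apply: (@integrable_bounded_mul _ _ _ _ _ _ 2) => //.
    apply: measurable_funB => //.
    exact: measurableT_comp (mH i) (measurable_rV_shift (- _)).
  by move=> x; apply: le_trans (ler_normB _ _) _; rewrite lerD.
under eq_fun do rewrite E.
have mV : measurable_fun setT V.
  by apply/measurable_EFinP; exact: (measurable_int _ Vi).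
apply: (cvg_Rintegral (g := fun x => M * `|V x|) _ _ _ _).2.
- by move=> n; exact: measurable_funM.
- move=> x; apply: cvgMr; exact: cvg_difference_quotient.
- exact/integrable_scale/integrable_normr.
- by move=> n x; rewrite normrM mulrC ler_wpM2r.
Qed.

(** For J(v) + J(g) <= J(u), stated for a pair of test fields so that no suprema have to be added.
    At step h the increments of v and g, paired with fields bounded by 1, are controlled by those of
    u, hence by J(u); then h tends to 0. *)
Lemma TV_split u v g H1 H2 :
  mu.-integrable setT (EFin \o (u \_ Omega)) ->
  mu.-integrable setT (EFin \o (v \_ Omega)) ->
  mu.-integrable setT (EFin \o (g \_ Omega)) ->
  (forall x y, `|v x - v y| + `|g x - g y| <= `|u x - u y|) ->
  test_field Omega H1 -> test_field Omega H2 ->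
  (\int[mu]_(x in Omega) (v x * divergence H1 x)%:E +
   \int[mu]_(x in Omega) (g x * divergence H2 x)%:E <=
   anisotropic_TV Omega u)%E.
Proof.
move=> Ui Vi Gi vgu tH1 tH2.
have [delta [delta0 d1 d2]] : exists delta : R, [/\ 0 < delta,
    closed_support H1 `<=` inner_box a l delta &
    closed_support H2 `<=` inner_box a l delta].
  near (0 : R)^'+ => delta; exists delta; split.
  - by near: delta; exact: nbhs_right_gt.
  - by near: delta; exact: test_field_inner.
  - by near: delta; exact: test_field_inner.
(* The denominator n + 2 makes [h n < delta] strict already at n = 0. *)
pose h n : R := delta * (n.+2%:R)^-1.
have h0 n : 0 < h n by rewrite mulr_gt0// invr_gt0.
have hd n : h n < delta.
  by rewrite /h -[ltRHS]mulr1 ltr_pM2l// invf_lt1// ltr1n.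
have hc : h @ \oo --> 0.
  rewrite -(mulr0 delta); apply: cvgMr.
  by have := @cvg_harmonic R; rewrite -(cvg_shiftS _)/=.
have [Vdi Vc] := cvg_integral_divergence tH1 Vi h0 hc.
have [Gdi Gc] := cvg_integral_divergence tH2 Gi h0 hc.
rewrite !integral_restrict// -EFinD.
set U := u \_ Omega in Ui *; set V := v \_ Omega in Vi Vdi Vc *.
set G := g \_ Omega in Gi Gdi Gc *.
pose T f H n := \sum_i (h n)^-1 * \int[mu]_x
  ((f x - f (x + h n *: delta_mx 0 i)) * H x 0 i).
have Tc : (fun n => (T V H1 n + T G H2 n)%:E) @ \oo -->
    (\int[mu]_x (V x * divergence H1 x) + \int[mu]_x
      (G x * divergence H2 x))%:E.
  by apply: cvg_EFin; [exact: nearW|exact: cvgD Vc Gc].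
rewrite -(cvg_lim _ Tc)//; apply: lime_le; first by apply/cvg_ex; eexists;
  exact: Tc.
apply: nearW => n; rewrite /T.
apply: le_trans
  (@difference_quotient_le_TV _ _ i0 a l u delta (h n) (h0 n) (hd n) Ui).
rewrite lee_fin -big_split/=; apply: ler_sum => i _.
rewrite -mulrDr ler_wpM2l// ?invr_ge0 ?(ltW (h0 n))//.
set e := h n *: delta_mx 0 i.
have Di (f : 'rV[R]_d -> R) : mu.-integrable setT (EFin \o f) ->
    mu.-integrable setT (fun x => (f x - f (x + e))%:E).
  by move=> fi; apply: integrable_sub => //; exact: (integrable_shift _ fi).
have mH j H : test_field Omega H -> measurable_fun setT (fun y => H y 0 j).
  by move=> tH; apply: continuous_measurable_rV;
    exact: (test_field_coord_continuous (i := j) tH).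
have DHi (f : 'rV[R]_d -> R) H : test_field Omega H ->
    mu.-integrable setT (EFin \o f) ->
    mu.-integrable setT (fun x => ((f x - f (x + e)) * H x 0 i)%:E).
  move=> tH fi; apply: (@integrable_bounded_mul _ _ _ _ _ _ 1).
  - exact: Di.
  - exact: mH.
  - by move=> x; exact: (test_field_coord_le1 _ _ tH).
rewrite -RintegralD//; try exact: DHi.
apply: le_Rintegral => //.
- by apply: integrable_add; exact: DHi.
- apply: integrable_normr.
  apply: (@integrable_bounded_mul _ _ _ _ _ _ 1).
  + exact: Di.
  + have mE := measurable_inner_box a l delta; exact: measurable_indic.
  + by move=> x; rewrite indicE; case: (x \in _);
    rewrite ?normr1 ?normr0 ?ler01.
move=> x _; rewrite indicE.
(* Off the inner box both fields vanish; on it x and x + e lie in [Omega], so the extensions by zero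
   coincide with the functions. *)
have [Ex|nEx] := pselect (inner_box a l delta x); last first.
  have -> : H1 x = 0 by apply: not_closed_support => /d1.
  have -> : H2 x = 0 by apply: not_closed_support => /d2.
  by rewrite mxE !mulr0 addr0.
have Ox : Omega x.
  by move: Ex => /inner_boxP xP j; have := xP j; lra.
have Oxe : Omega (x + e).
  move: Ex => /inner_boxP xP j; have := xP j; rewrite /e !mxE eqxx /=.
  by case: (j == i); rewrite ?mulr1 ?mulr0; have := hd n; have := h0 n; lra.
rewrite mem_set// mulr1 /U /V /G !patchE !mem_set//.
apply: le_trans (vgu x (x + e)).
apply: lerD.
  apply: le_trans (ler_norm _) _; rewrite normrM ler_piMr//.
  exact: (test_field_coord_le1 _ _ tH1).
apply: le_trans (ler_norm _) _; rewrite normrM ler_piMr//.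
exact: (test_field_coord_le1 _ _ tH2).
Unshelve. all: by end_near. Qed.

End split.
End test_fields.

(** * Optimality *)

Section L2_facts.
Context {R : realType} {d : nat}.
Notation mu := (lebesgue_rV R d).
Implicit Types (u v g : 'rV[R]_d -> R).

Let sqr_powR (f : 'rV[R]_d -> R) :
  (fun x => `|(EFin \o f) x| `^ 2)%E = (fun x => (f x ^+ 2)%:E).
Proof.
apply/funext => x.
by rewrite /= ?poweR_EFin powR_mulrn// real_normK// num_real.
Qed.

Lemma L2P (Om : set 'rV[R]_d) u : L2 Om u <->
  measurable_fun setT (u \_ Om) /\
  mu.-integrable setT (fun x => ((u \_ Om) x ^+ 2)%:E).
Proof.
split=> [uL|[mu2 iu]].
  split; last exact: (Lfun2_integrable_sqr uL).
  by have := sub_Lfun_mfun uL; rewrite inE.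
rewrite /L2/= inE; apply/andP; rewrite !inE; split => //=.
rewrite /finite_norm unlock; apply: poweR_lty.
rewrite sqr_powR.
exact: integrable_lty.
Qed.

Lemma L2norm_sqr (Om : set 'rV[R]_d) u : L2 Om u ->
  (L2norm Om u ^+ 2 = (\int[mu]_x ((u \_ Om) x ^+ 2))%:E)%E.
Proof.
move=> /L2P[mu2 iu]; rewrite /L2norm unlock.
rewrite sqr_powR.
rewrite /Rintegral -[X in (X `^ _)%E]fineK; last exact: integrable_fin_num iu.
rewrite poweR_EFin -EFin_expe; congr EFin.
rewrite -powR_mulrn ?powR_ge0// -powRrM mulVf// powRr1//.
by apply: Rintegral_ge0 => x _; exact: sqr_ge0.
Qed.

Lemma L2_mul_integrable (Om : set 'rV[R]_d) u v : L2 Om u -> L2 Om v ->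
  mu.-integrable setT (fun x => ((u \_ Om) x * (v \_ Om) x)%:E).
Proof. by move=> u2 v2; apply/Lfun1_integrable/Lfun2_mul_Lfun1. Qed.

Lemma restrictD (Om : set 'rV[R]_d) u v x :
  ((fun y => u y + v y) \_ Om) x = (u \_ Om) x + (v \_ Om) x.
Proof. by rewrite !patchE; case: ifP => // _; rewrite addr0. Qed.

Lemma restrictZ (Om : set 'rV[R]_d) (k : R) u x :
  ((fun y => k * u y) \_ Om) x = k * (u \_ Om) x.
Proof. by rewrite !patchE; case: ifP => // _; rewrite mulr0. Qed.

Lemma L2D (Om : set 'rV[R]_d) u v : L2 Om u -> L2 Om v ->
  L2 Om (fun x => u x + v x).
Proof.
move=> u2 v2; have uv := L2_mul_integrable u2 v2.
move: u2 v2 => /L2P[mu2 iu] /L2P[mv iv]; apply/L2P.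
rewrite (_ : _ \_ _ = fun x => (u \_ Om) x + (v \_ Om) x); last first.
  by apply/funext => x; exact: restrictD.
split; first exact: measurable_funD.
rewrite (_ : (fun x => _) = fun x => ((u \_ Om) x ^+ 2 +
   (2 * ((u \_ Om) x * (v \_ Om) x) + (v \_ Om) x ^+ 2))%:E); last first.
  by apply/funext => x; congr EFin; ring.
by apply: integrable_add => //; apply: integrable_add => //;
  exact: integrable_scale.
Qed.

Lemma L2Z (Om : set 'rV[R]_d) (k : R) u : L2 Om u -> L2 Om (fun x => k * u x).
Proof.
move=> /L2P[mu2 iu]; apply/L2P.
rewrite (_ : _ \_ _ = fun x => k * (u \_ Om) x); last first.
  by apply/funext => x; exact: restrictZ.
split; first exact: measurable_funM.
rewrite (_ : (fun x => _) = fun x => (k ^+ 2 * ((u \_ Om) x ^+ 2))%:E).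
  exact: integrable_scale.
by apply/funext => x; congr EFin; ring.
Qed.

Section finite_domain.
Variable Om : set 'rV[R]_d.
Hypotheses (mOm : measurable Om) (Omoo : (mu Om < +oo)%E).

Lemma integrable_indic_domain : mu.-integrable setT (fun x => (\1_Om x)%:E).
Proof.
apply/integrableP; split; first exact/measurable_EFinP.
under eq_integral do rewrite gee0_abs ?lee_fin//.
by rewrite integral_indic// setIT.
Qed.

(** On a domain of finite measure, |u| <= 1 + u^2 suffices. *)
Lemma L2_integrable u : L2 Om u -> mu.-integrable setT (EFin \o (u \_ Om)).
Proof.
move=> /L2P[mu2 iu].
have := integrable_add integrable_indic_domain iu.
apply: le_integrable => //; first exact/measurable_EFinP.
move=> x _; rewrite lee_fin.
rewrite [leRHS]ger0_norm ?addr_ge0 ?sqr_ge0//.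
rewrite patchE indicE; case: ifP => _; rewrite ?normr0 ?addr_ge0 ?sqr_ge0//=.
rewrite -(@real_normK _ (u x)) ?num_real//; set z := `|u x|.
have : 0 <= (z - 1) ^+ 2 by rewrite sqr_ge0.
have : 0 <= z by rewrite /z.
nra.
Qed.

Lemma L2_comp (psi : R -> R) (C : R) u : continuous psi ->
  (forall x, `|psi x| <= C * (1 + `|x|)) -> L2 Om u -> L2 Om (psi \o u).
Proof.
move=> cpsi psiC /L2P[mu2 iu]; apply/L2P.
(* The indicator is there because [psi 0] may differ from 0. The domination below uses (1 + |u|)^2
   <= 2 (1 + u^2). *)
have E : (psi \o u) \_ Om = fun x => \1_Om x * psi ((u \_ Om) x).
  apply/funext => x; rewrite !patchE indicE.
  by case: ifP => _; rewrite ?mul1r ?mul0r.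
have mpsi : measurable_fun setT ((psi \o u) \_ Om).
  rewrite E; apply: measurable_funM => //.
  apply: (measurableT_comp (f := psi)); last exact: mu2.
  exact: continuous_measurable_fun.
split => //.
have := integrable_scale (C ^+ 2 * 2)
  (integrable_add integrable_indic_domain iu).
apply: le_integrable => //.
  by apply/measurable_EFinP; exact: measurable_funX.
move=> x _; rewrite lee_fin !ger0_norm ?sqr_ge0//; last first.
  by apply: mulr_ge0; [rewrite mulr_ge0 ?sqr_ge0|rewrite addr_ge0 ?sqr_ge0].
rewrite /= !patchE indicE; case: ifP => _; last first.
  rewrite expr0n/=.
  by apply: mulr_ge0; [rewrite mulr_ge0 ?sqr_ge0|rewrite addr_ge0].
rewrite /= -(@real_normK _ (psi (u x))) ?num_real// -(@real_normK _ (u x))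
  ?num_real//.
apply: (@le_trans _ _ ((C * (1 + `|u x|)) ^+ 2)).
  by rewrite lerXn2r ?nnegrE//; apply: le_trans (psiC _).
rewrite exprMn -mulrA ler_wpM2l ?sqr_ge0//.
have : 0 <= (`|u x| - 1) ^+ 2 by rewrite sqr_ge0.
nra.
Qed.

End finite_domain.
End L2_facts.

(** * First variation at the minimizer *)

Section optimality.
Context {R : realType} {d : nat} (i0 : 'I_d).
Notation mu := (lebesgue_rV R d).
Variables (a l : 'rV[R]_d) (l_gt0 : forall i, 0 < l 0 i).
Let Omega := hyperrectangle a l.

Lemma measurable_hyperrectangle : measurable Omega.
Proof.
rewrite (_ : Omega = open_box a (a + l)); first exact: measurable_open_box.
by apply/seteqP; split => x h i; have := h i; rewrite ?mxE.
Qed.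

Lemma hyperrectangle_fin : (mu Omega < +oo)%E.
Proof. by rewrite lebesgue_rV_hyperrectangle ?ltry// => i; exact: ltW. Qed.

Let mO := measurable_hyperrectangle.
Let Ooo := hyperrectangle_fin.

Lemma test_field0 : test_field Omega (fun=> 0).
Proof.
have H0 : closed_support (fun=> 0 : 'rV[R]_d) = set0.
  rewrite /closed_support (_ : [set x | _] = set0) ?closure0//.
  by apply/seteqP; split => // x /=; rewrite eqxx.
split; rewrite ?H0//.
- move=> i; rewrite (_ : (fun x => _) = fun=> 0).
    exact/tensor_smooth/tensor0.
  by apply/funext => x; rewrite mxE.
- exact: compact0.
- by move=> x _; rewrite normr0.
Qed.

Lemma divergence0 x : divergence (fun=> 0 : 'rV[R]_d) x = 0.
Proof.
rewrite /divergence big1// => i _.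
rewrite /partial (_ : (fun y => _) = fun=> 0) ?derive_cst//.
by apply/funext => y; rewrite mxE.
Qed.

Lemma TV_ge0 (u : 'rV[R]_d -> R) : (0 <= anisotropic_TV Omega u)%E.
Proof.
apply: ereal_sup_ubound; exists (fun=> 0); first exact: test_field0.
by rewrite integral0_eq// => x _; rewrite divergence0 mulr0.
Qed.

Lemma TV0 : anisotropic_TV Omega (fun=> 0) = 0%E.
Proof.
apply/eqP; rewrite eq_le TV_ge0 andbT; apply: ge_ereal_sup => _ [H _ <-].
by rewrite integral0_eq// => x _; rewrite mul0r.
Qed.

Lemma L20 : L2 Omega (fun=> 0).
Proof.
apply/L2P; rewrite (_ : _ \_ _ = fun=> 0); last first.
  by apply/funext => x; rewrite patchE; case: ifP.
split => //; under eq_fun do rewrite expr0n/=.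
exact: integrable0.
Qed.

Lemma ROF_L2 (f u : 'rV[R]_d -> R) (alpha : R) : L2 Omega f -> L2 Omega u ->
  ROF Omega f alpha u =
  ((2^-1 * \int[mu]_x (((u \_ Omega) x - (f \_ Omega) x) ^+ 2))%:E +
   alpha%:E * anisotropic_TV Omega u)%E.
Proof.
move=> f2 u2; rewrite /ROF L2norm_sqr.
  congr (_ + _)%E; rewrite -EFinM; congr (_ * _)%:E.
  by apply: eq_Rintegral => x _; rewrite !patchE; case: ifP;
    rewrite ?subrr ?subr0.
rewrite (_ : (u \- f) = fun x => u x + (-1) * f x); first exact/L2D/L2Z.
by apply/funext => x; rewrite /= mulN1r.
Qed.

(** Comparison with the competitor 0, whose energy is finite. A finite J(u_f) can then be subtracted
    in the variation. *)
Lemma minimizer_TV_fin (f u : 'rV[R]_d -> R) (alpha : R) : 0 < alpha ->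
  L2 Omega f -> ROF_minimizer Omega f alpha u ->
  exists r, anisotropic_TV Omega u = r%:E.
Proof.
move=> alpha0 f2 [u2 /(_ _ L20)]; rewrite !ROF_L2//; last exact: L20.
rewrite TV0 mule0 adde0.
have := TV_ge0 u; case: (anisotropic_TV Omega u) => [r _ _|_|//];
  first by exists r.
by rewrite gt0_muley ?lte_fin// addey.
Qed.

(* Since psi splits the total variation of u_f, comparing u_f with
   u_f - t psi(u_f) and letting t tend to 0 gives the inequality. *)
Lemma minimizer_variation (f uf p : 'rV[R]_d -> R) (alpha : R) (psi : R -> R) :
  0 < alpha -> L2 Omega f -> ROF_minimizer Omega f alpha uf ->
  subdiff0 Omega p ->
  (forall x y, x <= y -> 0 <= psi y - psi x <= y - x) ->
  0 <= \int[mu]_x (((f \_ Omega) x - alpha * (p \_ Omega) x - (uf \_ Omega) x) *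
                   ((psi \o uf) \_ Omega) x).
Proof.
move=> alpha0 f2 ufm [p2 pJ] psi1.
have [r Jr] := minimizer_TV_fin alpha0 f2 ufm.
have [uf2 ufmin] := ufm.
have psiL x y : `|psi x - psi y| <= `|x - y|.
  wlog xy : x y / x <= y => [hw|].
    have [/hw//|/ltW/hw] := leP x y.
    by rewrite distrC [X in _ <= X]distrC.
  have /andP[q1 q2] := psi1 _ _ xy.
  rewrite [`|x - y|]ler0_norm ?subr_le0// ler0_norm; lra.
have cpsi : continuous psi.
  move=> x; apply/cvgrPdist_lt => e e0; near=> y.
  apply: le_lt_trans (psiL _ _) _.
  by near: y; exact: cvgr_dist_lt.
have g2 : L2 Omega (psi \o uf).
  (* The linear growth |psi x| <= |x| + |psi 0| <= (1 + |psi 0|)(1 + |x|). *)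
  apply: (@L2_comp _ _ _ mO Ooo _ (1 + `|psi 0|)) => // x.
  have := psiL x 0; rewrite subr0 => psi_x.
  have : `|psi x| <= `|psi x - psi 0| + `|psi 0|.
    by rewrite -[X in `|X| <= _](subrK (psi 0)) ler_normD.
  have : 0 <= `|psi 0| * `|x| by rewrite mulr_ge0.
  lra.
have h2 := L2D f2 (L2D (L2Z (- alpha) p2) (L2Z (-1) uf2)).
have UFi := L2_mul_integrable (L2D uf2 (L2Z (-1) f2)) g2.
have UF2 := (L2P _ _).1 (L2D uf2 (L2Z (-1) f2)).
have PGi := L2_mul_integrable p2 g2.
have [_ GGi] := (L2P _ _).1 g2.
set F := f \_ Omega; set P := p \_ Omega; set U := uf \_ Omega.
set G := (psi \o uf) \_ Omega.
have UFE x : ((fun x => uf x + -1 * f x) \_ Omega) x = U x - F x.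
  by rewrite restrictD restrictZ mulN1r.
have {}UFi : mu.-integrable setT (fun x => ((U x - F x) * G x)%:E).
  by apply: eq_integrable UFi => // x _; rewrite UFE.
have {UF2}[_ UF2] := UF2.
have {}UF2 : mu.-integrable setT (fun x => ((U x - F x) ^+ 2)%:E).
  by apply: eq_integrable UF2 => // x _; rewrite UFE.
pose A := \int[mu]_x ((U x - F x) ^+ 2).
pose B := \int[mu]_x ((U x - F x) * G x).
pose K := \int[mu]_x (G x ^+ 2).
pose c := \int[mu]_x (P x * G x).
have -> : \int[mu]_x ((F x - alpha * P x - U x) * G x) = - B - alpha * c.
  rewrite /B /c -[- \int[mu]_x _]mulN1r -!RintegralZl//.
  rewrite -RintegralB//; try exact: integrable_scale.
  by apply: eq_Rintegral => x _; ring.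
(* Minimality against [v], divided by t. The bound t <= 1 makes t psi again nondecreasing and
   1-Lipschitz, so that [v] and [w] split the increments of [uf]. *)
have key t : 0 < t -> t <= 1 -> 0 <= (- B - alpha * c) + t / 2 * K.
  move=> t0 t1.
  pose v x := uf x + (- t) * (psi \o uf) x.
  pose w x := t * (psi \o uf) x.
  have v2 : L2 Omega v by apply: L2D => //; exact: L2Z.
  have w2 : L2 Omega w by exact: L2Z.
  have VE x : (v \_ Omega) x = U x - t * G x.
    by rewrite restrictD restrictZ mulNr.
  have WE x : (w \_ Omega) x = t * G x by rewrite restrictZ.
  have vw x y : `|v x - v y| + `|w x - w y| <= `|uf x - uf y|.
    rewrite /v /w /=; set b := uf x; set b' := uf y.
    have [bb|bb] := leP b b'.
      have /andP[q1 q2] := psi1 _ _ bb.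
      have ? : 0 <= t * (psi b' - psi b) by rewrite mulr_ge0// ltW.
      have ? : t * (psi b' - psi b) <= psi b' - psi b by rewrite ler_piMl.
      rewrite [`|b - b'|]ler0_norm ?subr_le0// ler0_norm; last lra.
      by rewrite ler0_norm; lra.
    have /andP[q1 q2] := psi1 _ _ (ltW bb).
    have ? : 0 <= t * (psi b - psi b') by rewrite mulr_ge0// ltW.
    have ? : t * (psi b - psi b') <= psi b - psi b' by rewrite ler_piMl.
    rewrite [`|b - b'|]gtr0_norm ?subr_gt0// ger0_norm; last lra.
    by rewrite ger0_norm; lra.
  have sp H1 H2 := @TV_split _ _ i0 a l uf v w H1 H2 (L2_integrable mO Ooo uf2)
    (L2_integrable mO Ooo v2) (L2_integrable mO Ooo w2) vw.
  have pw : (\int[mu]_(x in Omega) (p x * w x)%:E)%E = (t * c)%:E.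
    have PWi : mu.-integrable setT (fun x => (P x * w x)%:E).
      apply: eq_integrable (L2_mul_integrable p2 w2) => // x _.
      by rewrite /P !patchE; case: ifP => //; rewrite !mul0r.
    rewrite (integral_restrict PWi) /c -RintegralZl//; congr EFin.
    apply: eq_Rintegral => x _; rewrite /P /G /w !patchE.
    by case: ifP => _; rewrite ?mul0r ?mulr0// mulrCA.
  have Jw := pJ w w2; rewrite pw in Jw.
  (* For fixed [H1] with integral [x1], the supremum over [H2] gives J(w) <= r - x1, while [p] gives
     t c <= J(w). The choice H2 = 0 first rules out x1 = +oo. *)
  have Jv : (anisotropic_TV Omega v <= (r - t * c)%:E)%E.
    apply: ge_ereal_sup => _ [H1 tH1 <-].
    have sp1 H2 := @sp H1 H2 tH1.
    rewrite Jr in sp1; set x1 := integral _ _ _ in sp1 *.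
    have x1r : (x1 <= r%:E)%E.
      have := sp1 _ test_field0; rewrite [X in (_ + X)%E]integral0_eq ?adde0//.
      by move=> x _; rewrite divergence0 mulr0.
    move: x1 sp1 x1r => [x1| |] sp1 x1r; rewrite ?leNye//.
    have : (anisotropic_TV Omega w <= (r - x1)%:E)%E.
      apply: ge_ereal_sup => _ [H2 tH2 <-].
      by rewrite EFinB leeBrDl//; exact: sp1.
    move=> /(le_trans Jw); rewrite !lee_fin; lra.
  have := ufmin v v2; rewrite !ROF_L2// Jr.
  move: Jv (TV_ge0 v); case: (anisotropic_TV Omega v) => [r'| |]//.
  rewrite -!EFinM -!EFinD !lee_fin => r'r _.
  rewrite -/U -/F -/A.
  have -> : \int[mu]_x (((v \_ Omega) x - F x) ^+ 2) = A +
    (- (2 * t) * B + t ^+ 2 * K).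
    rewrite /A /B /K -!RintegralZl// -!RintegralD//.
    - by apply: eq_Rintegral => x _; rewrite VE; ring.
    - by apply: integrable_add; exact: integrable_scale.
    - exact: integrable_scale.
    - exact: integrable_scale.
  move=> le1.
  have le2 : alpha * r' <= alpha * (r - t * c) by rewrite ler_wpM2l// ltW.
  have : 0 <= t * (- B - alpha * c + t / 2 * K) by lra.
  by rewrite pmulr_rge0.
have K0 : 0 <= K by apply: Rintegral_ge0 => x _; exact: sqr_ge0.
rewrite leNgt; apply/negP => D0; set D := _ - _ in key D0.
have KD : 0 < K - D by lra.
(* If D < 0, this t lies in ]0, 1] and satisfies t K <= - D, so D + t K / 2 <= D / 2 < 0, against
   [key]. *)
have t0 : 0 < - D / (K - D) by rewrite divr_gt0//; lra.
have t1 : - D / (K - D) <= 1 by rewrite ler_pdivrMr// mul1r; lra.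
have := key _ t0 t1.
have : - D / (K - D) * K <= - D.
  by rewrite mulrAC ler_pdivrMr// ler_wpM2l//; lra.
lra.
Unshelve. all: by end_near. Qed.

End optimality.

(** * Convex functions *)

Section convex.
Context {R : realType}.
Variable phi : R -> R.
Hypothesis phi_convex : convex_function [set: R^o] phi.

(** Convexity with weight (z - y) / (z - x) at x, cleared of denominators so that y may coincide
    with an end. *)
Lemma convex_three_points (x y z : R) : x <= y -> y <= z -> x < z ->
  phi y * (z - x) <= (z - y) * phi x + (y - x) * phi z.
Proof.
move=> xy yz xz; have zx0 : 0 < z - x by rewrite subr_gt0.
have t0 : 0 <= (z - y) / (z - x) by rewrite divr_ge0 ?subr_ge0// ltW.
have t1 : (z - y) / (z - x) <= 1 by rewrite ler_pdivrMr// mul1r lerD2l lerN2.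
have := phi_convex (Itv01 t0 t1) (mem_setT x) (mem_setT z).
rewrite convRE /conv/= /GRing.scale/= /unstable.onem.
have -> : (z - y) / (z - x) * x + (1 - (z - y) / (z - x)) * z = y.
  by field; rewrite gt_eqF.
move=> h; have {h} := ler_wpM2r (ltW zx0) h.
move/le_trans; apply; rewrite le_eqVlt; apply/orP; left; apply/eqP.
by field; rewrite gt_eqF.
Qed.

Definition chord (x y : R) : R := (phi y - phi x) / (y - x).

(** The chord from x to y' shares an end with each of the two and lies between them in slope. *)
Lemma chord_le (x y x' y' : R) : x < y -> x' < y' -> x <= x' -> y <= y' ->
  chord x y <= chord x' y'.
Proof.
move=> xy xy' xx yy; have xy1 : x < y' by exact: lt_le_trans yy.
have d1 : 0 < y - x by rewrite subr_gt0.
have d2 : 0 < y' - x' by rewrite subr_gt0.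
have d3 : 0 < y' - x by rewrite subr_gt0.
apply: (@le_trans _ _ (chord x y')).
  rewrite /chord ler_pdivrMr// mulrAC ler_pdivlMr//.
  have := convex_three_points (ltW xy) yy xy1; lra.
rewrite /chord ler_pdivrMr// mulrAC ler_pdivlMr//.
have := convex_three_points xx (ltW xy') xy1; lra.
Qed.

Lemma chordK (x y : R) : x < y -> phi y - phi x = chord x y * (y - x).
Proof. by move=> xy; rewrite /chord divfK// subr_eq0 gt_eqF. Qed.

Let e (k : nat) : R := k.+1%:R^-1.
Let e0 k : 0 < e k. Proof. by rewrite invr_gt0. Qed.
Let e1 k : e k <= 1. Proof. by rewrite invf_le1// ler1n. Qed.

Definition left_chord (k : nat) (x : R) : R := chord (x - e k) x.

Let left_chordE k (x : R) : left_chord k x = (phi x - phi (x - e k)) / e k.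
Proof. by rewrite /left_chord /chord opprB addrCA subrr addr0. Qed.

Definition left_slope (x : R) : R := limn (left_chord ^~ x).

Lemma left_chord_nd k (x y : R) : x <= y -> left_chord k x <= left_chord k y.
Proof. by move=> xy; apply: chord_le; rewrite ?ltrBlDr ?ltrDl ?lerD2r ?e0. Qed.

Let left_chord_seq (x : R) : nondecreasing_seq (left_chord ^~ x).
Proof.
move=> m n mn; apply: chord_le; rewrite ?ltrBlDr ?ltrDl ?e0//.
by rewrite lerD2l lerN2 lef_pV2 ?posrE// ler_nat.
Qed.

Lemma left_chord_le k (x y : R) : x < y -> left_chord k x <= chord x y.
Proof. by move=> xy; apply: chord_le; rewrite ?gerBl ?ltrBlDr ?ltrDl ?e0 ?ltW.
Qed.

Lemma left_chord_cvg (x : R) : left_chord ^~ x @ \oo --> left_slope x.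
Proof.
have : cvgn (left_chord ^~ x).
  apply: nondecreasing_is_cvgn; first exact: left_chord_seq.
  exists (chord x (x + 1)) => _ [k _ <-]; apply: left_chord_le.
  by rewrite ltrDl.
exact.
Qed.

Let left_chord_cvgn (x : R) : cvgn (left_chord ^~ x).
Proof. by apply/cvg_ex; exists (left_slope x); exact: left_chord_cvg. Qed.

Lemma left_slope_nd (x y : R) : x <= y -> left_slope x <= left_slope y.
Proof.
move=> xy; apply: ler_lim => //; apply: nearW => k; exact: left_chord_nd.
Qed.

(** For y > x every left chord at x is below the chord to y. For y < x the left chords start to the
    right of y once [e k] <= x - y, and are then above the chord from y. *)
Lemma left_slope_subgradient (x y : R) :
  phi x + left_slope x * (y - x) <= phi y.
Proof.
rewrite addrC -lerBrDr; have [xy|yx|->] := ltgtP x y.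
- rewrite chordK// ler_wpM2r ?subr_ge0 ?(ltW xy)//.
  by apply: limr_le => //; apply: nearW => k; exact: left_chord_le.
- rewrite -lerN2 opprB -mulrN opprB chordK// ler_wpM2r ?subr_ge0 ?(ltW yx)//.
  apply: limr_ge => //.
  have xy0 : 0 < (x - y)^-1 by rewrite invr_gt0 subr_gt0.
  near=> k; apply: chord_le; rewrite ?ltrBlDr ?ltrDl ?e0//.
  rewrite lerBrDr -lerBrDl /e -[leRHS]invrK lef_pV2 ?posrE//.
  rewrite ltW// (lt_le_trans (truncnS_gt _))// ler_nat ltnS.
  by near: k; exists (Num.trunc (x - y)^-1).
- by rewrite !subrr mulr0.
Unshelve. all: by end_near. Qed.

(** Squeezed between the chords over [-N-2, -N-1] and [N, N+1]. The extra unit on the left makes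
    room for left chords, which reach back by [e k] <= 1. *)
Lemma chord_bounded (N : R) : exists2 L, 0 < L & forall x y : R,
  - N - 1 <= x -> x < y -> y <= N -> `|chord x y| <= L.
Proof.
pose A := chord (- N - 2) (- N - 1); pose B := chord N (N + 1).
exists (`|A| + `|B| + 1) => [|x y Nx xy yN].
  by rewrite ltr_pwDr// addr_ge0.
have hA : A <= chord x y by apply: chord_le; lra.
have hB : chord x y <= B by apply: chord_le; lra.
have := ler_norm (- A); have := ler_norm B; rewrite normrN => ? ?.
have := normr_ge0 A; have := normr_ge0 B => ? ?.
by rewrite ler_norml; lra.
Qed.

Lemma convex_continuous : continuous phi.
Proof.
move=> x; pose N : R := `|x| + 1.
have [L L0 LN] := chord_bounded N.
have Lip y z : - N <= y -> y <= z -> z <= N -> `|phi z - phi y| <= L * (z - y).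
  move=> Ny; rewrite le_eqVlt => /predU1P[->|yz] zN.
    by rewrite !subrr normr0 mulr0.
  rewrite chordK// normrM [`|z - y|]gtr0_norm ?subr_gt0//.
  by rewrite ler_wpM2r ?subr_ge0 ?(ltW yz)// LN//; lra.
have /andP[xN xN'] : - N < x < N by rewrite -ltr_norml /N ltrDl.
apply/cvgrPdist_lt => eps eps0; near=> y.
have : `|x - y| < eps / L by near: y; apply: cvgr_dist_lt => //;
  rewrite divr_gt0.
rewrite ltr_pdivlMr// mulrC; apply: le_lt_trans.
have yN : - N < y < N.
  by apply/andP; split; near: y; [exact: lt_nbhsr|exact: lt_nbhsl].
have [xy|yx] := leP x y.
  rewrite distrC [`|x - y|]distrC [`|y - x|]ger0_norm ?subr_ge0//.
  by apply: Lip => //; lra.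
rewrite [`|x - y|]gtr0_norm ?subr_gt0//.
by apply: Lip; lra.
Unshelve. all: by end_near. Qed.

Definition clamp (N x : R) : R := Num.max (- N) (Num.min x N).

Lemma clamp_itv (N x : R) : 0 <= N -> - N <= clamp N x <= N.
Proof.
move=> N0; rewrite /clamp le_max lexx/= ge_max ge_min lexx orbT andbT.
by rewrite (le_trans _ N0)// oppr_le0.
Qed.

Lemma clamp_lipschitz (N x y : R) : x <= y ->
  0 <= clamp N y - clamp N x <= y - x.
Proof.
move=> xy; rewrite /clamp.
have : 0 <= Num.min y N - Num.min x N <= y - x.
  by case: (leP x N) => ?; case: (leP y N) => ?; apply/andP; split; lra.
move: (Num.min y N) (Num.min x N) => q p /andP[pq qp].
by case: (leP (- N) p) => ?; case: (leP (- N) q) => ?; apply/andP; split; lra.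
Qed.

Lemma clamp_id (N x : R) : `|x| <= N -> clamp N x = x.
Proof.
by rewrite ler_norml => /andP[h1 h2]; rewrite /clamp min_l// max_r.
Qed.

(** With b, c the clamped points, the difference of left chords is (b - c) / e_k times a difference
    of two chords bounded by L, whence C = 2 L / e_k. *)
Lemma left_chord_clamp_lipschitz (N : R) k : 0 <= N ->
  exists2 C, 0 < C & forall x y, x <= y ->
    0 <= left_chord k (clamp N y) - left_chord k (clamp N x) <= C * (y - x).
Proof.
move=> N0; have [L L0 LN] := chord_bounded N.
have ek := e0 k; have ek1 := e1 k.
exists (2 * L / e k); first by rewrite divr_gt0// mulr_gt0.
move=> x y xy; have /andP[c1 c2] := clamp_lipschitz N xy.
rewrite subr_ge0 left_chord_nd /=; last by rewrite -subr_ge0.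
move: c2.
have /andP[x1 x2] := clamp_itv x N0; have /andP[y1 y2] := clamp_itv y N0.
set b := clamp N y in c1 y1 y2 *; set c := clamp N x in c1 x1 x2 *.
move=> h; apply: (@le_trans _ _ (2 * L / e k * (b - c))); last first.
  by rewrite ler_wpM2l// divr_ge0 ?mulr_ge0 ?ltW.
move: c1; rewrite subr_ge0 le_eqVlt => /predU1P[<-|cb].
  by rewrite !subrr mulr0.
rewrite !left_chordE -mulrBl.
rewrite ler_pdivrMr// (_ : 2 * L / e k * (b - c) * e k = 2 * L * (b - c)).
  2: by field; rewrite gt_eqF.
have E1 := chordK cb.
have cb' : c - e k < b - e k by rewrite ltrD2r.
have E2 := chordK cb'.
have N1 : `|chord c b| <= L by apply: LN => //; lra.
have N2 : `|chord (c - e k) (b - e k)| <= L by apply: LN => //; lra.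
have -> : phi b - phi (b - e k) - (phi c - phi (c - e k)) =
    (chord c b - chord (c - e k) (b - e k)) * (b - c).
  rewrite mulrBl -E1; move: E2; rewrite (_ : b - e k - (c - e k) = b - c);
    last ring.
  by move=> <-; ring.
rewrite ler_wpM2r ?subr_ge0 ?(ltW cb)//.
by move: N1 N2; rewrite !ler_norml; lra.
Qed.

Lemma left_chord_clamp_bounded (N : R) : 0 <= N ->
  exists L, forall k x, `|left_chord k (clamp N x)| <= L.
Proof.
move=> N0; have [L L0 LN] := chord_bounded N; exists L => k x.
have /andP[x1 x2] := clamp_itv x N0; have := e0 k; have := e1 k => ? ?.
by apply: LN => //; lra.
Qed.

(** [phi] on [-N, N], continued outside by its tangents at the ends: its linear growth makes it
    integrable along integrable functions. *)
Definition tangent_ext (N x : R) : R :=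
  phi (clamp N x) + left_slope (clamp N x) * (x - clamp N x).

(** The left side is the value at y of the tangent of [phi] at [clamp N x]. *)
Lemma tangent_ext_le (N x y : R) :
  tangent_ext N x + left_slope (clamp N x) * (y - x) <= phi y.
Proof.
apply: le_trans (left_slope_subgradient (clamp N x) y).
by rewrite /tangent_ext -addrA -mulrDr addrC [_ + (y - x)]addrC subrKA addrC.
Qed.

(** An affine minorant independent of N, as Fatou's lemma requires. The slope is monotone, so beyond
    the ends the tangents leave the one at 0 in the right direction. *)
Lemma tangent_ext_ge (N x : R) : 0 <= N ->
  phi 0 + left_slope 0 * x <= tangent_ext N x.
Proof.
move=> N0; rewrite /tangent_ext; set c := clamp N x.
have h1 := left_slope_subgradient 0 c; rewrite subr0 in h1.
suff : left_slope 0 * (x - c) <= left_slope c * (x - c) by lra.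
have [xN|Nx] := leP x N; last first.
  have cN : c = N by rewrite /c /clamp min_r ?(ltW Nx)// max_r//; lra.
  rewrite cN ler_wpM2r ?subr_ge0 ?(ltW Nx)//; exact: left_slope_nd.
have [Nx|xN'] := leP (- N) x.
  by rewrite /c clamp_id ?subrr ?mulr0// ler_norml Nx.
have -> : c = - N by rewrite /c /clamp min_l// max_l// ltW.
rewrite ler_wnM2r//; first by lra.
by apply: left_slope_nd; rewrite oppr_le0.
Qed.

Lemma tangent_ext_id (N x : R) : `|x| <= N -> tangent_ext N x = phi x.
Proof. by move=> xN; rewrite /tangent_ext clamp_id// subrr mulr0 addr0. Qed.

Lemma clamp_continuous (N : R) : continuous (clamp N).
Proof.
move=> x; apply: (@continuous_max _ _ (fun=> - N) (fun y => Num.min y N)).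
  exact: cvg_cst.
by apply: (@continuous_min _ _ id (fun=> N)); [exact: cvg_id|exact: cvg_cst].
Qed.

Lemma measurable_left_chord k : measurable_fun [set: R] (left_chord k).
Proof.
have mphi := continuous_measurable_fun convex_continuous.
have -> : left_chord k = fun x => (phi x - phi (x - e k)) * (e k)^-1.
  by apply/funext => x; exact: left_chordE.
apply: measurable_funM => //; apply: measurable_funB => //.
by apply: measurableT_comp => //; exact: measurable_funB.
Qed.

Lemma measurable_left_slope : measurable_fun [set: R] left_slope.
Proof.
apply: (measurable_fun_cvg (h := left_chord)) => [k|x _].
  exact: measurable_left_chord.
exact: left_chord_cvg.
Qed.

End convex.

(** * Integration of the subgradient inequality *)

Section convex_integral.
Context {dT : measure_display} {T : measurableType dT} {R : realType}.
Variable mu : {measure set T -> \bar R}.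
Variables (D : set T) (mD : measurable D).

(** Positive and negative parts are compared separately, so the integrals may be infinite, as that
    of phi(u) can be. *)
Lemma le_integral_measurable (f g : T -> \bar R) : measurable_fun D f ->
  measurable_fun D g -> (forall x, D x -> (f x <= g x)%E) ->
  (\int[mu]_(x in D) f x <= \int[mu]_(x in D) g x)%E.
Proof.
move=> mf mg fg; rewrite integralE [leRHS]integralE; apply: leeB.
  apply: ge0_le_integral => //.
  - exact: measurable_funepos.
  - exact: measurable_funepos.
  - by move=> x Dx; rewrite !funeposE ge_max le_max fg//= le_max lexx orbT.
apply: ge0_le_integral => //.
- exact: measurable_funeneg.
- exact: measurable_funeneg.
- by move=> x Dx; rewrite !funenegE ge_max le_max leeN2 fg//= le_max lexx orbT.
Qed.

Hypothesis Dfin : (mu D < +oo)%E.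

Variables (phi : R -> R) (u v : T -> R).
Hypothesis phi_convex : convex_function [set: R^o] phi.
Hypotheses (ui : mu.-integrable D (EFin \o u))
  (vi : mu.-integrable D (EFin \o v)).

Let integrable_affine (w : T -> R) (A B : R) : mu.-integrable D (EFin \o w) ->
  mu.-integrable D (fun x => (A + B * w x)%:E).
Proof.
move=> wi; have Ai : mu.-integrable D (EFin \o cst A).
  apply/integrableP; split; first exact/measurable_EFinP.
  rewrite [ltLHS](@integral_cst _ _ _ mu _ mD `|A|%:E) -ge0_fin_numE;
    last first.
    by rewrite mule_ge0.
  by rewrite fin_numM// ge0_fin_numE.
exact: (integrableD mD Ai (integrableZl mD B wi)).
Qed.

Let mphi : measurable_fun setT phi.
Proof. exact: continuous_measurable_fun (convex_continuous phi_convex). Qed.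

Let mu_ : measurable_fun D u.
Proof. by apply/measurable_EFinP; exact: measurable_int ui. Qed.

Let mv : measurable_fun D v.
Proof. by apply/measurable_EFinP; exact: measurable_int vi. Qed.

Let s := left_slope phi.
Let c n := clamp (n%:R : R).
Let t n x := tangent_ext phi (n%:R : R) (v x).

Let ms : measurable_fun setT s := measurable_left_slope phi_convex.

Let mc n : measurable_fun setT (c n).
Proof. exact: continuous_measurable_fun (@clamp_continuous _ _). Qed.

Let msc n : measurable_fun D (fun x => s (c n (v x))).
Proof. by apply: measurableT_comp => //; exact: measurableT_comp. Qed.

Let mt n : measurable_fun D (t n).
Proof.
have mcv : measurable_fun D (fun x => c n (v x)) by exact: measurableT_comp.
apply: measurable_funD; first exact: measurableT_comp.
by apply: measurable_funM; [exact: msc|exact: measurable_funB].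
Qed.

Let sc_bounded n : exists L, forall x, `|s (c n x)| <= L.
Proof.
have [L LP] := left_chord_clamp_bounded phi_convex (ler0n R n); exists L => x.
have sl := left_chord_cvg phi_convex (x := c n x).
rewrite -(cvg_lim _ (cvg_norm sl))//; apply: limr_le; last first.
  by apply: nearW => k; exact: LP.
by apply/cvg_ex; eexists; exact: (cvg_norm sl).
Qed.

Let ti n : mu.-integrable D (EFin \o t n).
Proof.
have [L LP] := sc_bounded n.
have vni : mu.-integrable D (EFin \o (fun x => `|v x|))
  by exact: integrable_norm.
have := integrable_affine `|phi 0| (`|s 0| + L) vni.
apply: le_integrable => //; first exact/measurable_EFinP.
move=> x Dx; rewrite lee_fin [leRHS]ger0_norm; last first.
  by rewrite addr_ge0// mulr_ge0// addr_ge0// (le_trans _ (LP 0%R)).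
have lo : phi 0 + s 0 * v x <= t n x by exact: tangent_ext_ge.
(* The tangent evaluated at 0 bounds [t n x] from above by a function of linear growth in v. *)
have hi : t n x + s (c n (v x)) * (0 - v x) <= phi 0 by exact: tangent_ext_le.
have svL : `|s (c n (v x)) * v x| <= L * `|v x| by rewrite normrM ler_wpM2r.
have s0v : `|s 0 * v x| = `|s 0| * `|v x| by rewrite normrM.
rewrite sub0r mulrN in hi.
move: svL; rewrite ler_norml => /andP[svL1 svL2].
have := ler_norm (s 0 * v x); have := ler_norm (- (s 0 * v x)).
have := ler_norm (phi 0); have := ler_norm (- phi 0).
have : 0 <= `|s 0| * `|v x| by rewrite mulr_ge0.
have : 0 <= L * `|v x| by rewrite mulr_ge0// (le_trans _ (LP 0%R)).
by rewrite !normrN s0v ler_norml => *; apply/andP; split; lra.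
Qed.

(** Here v is the minimizer. The hypothesis and the tangent inequality bound the integral of [t n]
    by that of phi(u); pointwise [t n] is eventually phi(v), and Fatou's lemma applies to the
    nonnegative [t n - ell]. *)
Lemma convex_integral_le :
  (forall n : nat, 0 <= \int[mu]_(x in D) ((u x - v x) * s (c n (v x)))) ->
  (\int[mu]_(x in D) (phi (v x))%:E <= \int[mu]_(x in D) (phi (u x))%:E)%E.
Proof.
move=> H; set M := integral mu D (fun x => (phi (u x))%:E).
pose ell x := phi 0 + s 0 * v x.
have elli : mu.-integrable D (EFin \o ell) by exact: integrable_affine.
pose k := \int[mu]_(x in D) ell x.
have tM n : ((\int[mu]_(x in D) t n x)%:E <= M)%E.
  have [L LP] := sc_bounded n.
  have di : mu.-integrable D (fun x => ((u x - v x) * s (c n (v x)))%:E).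
    have uvi : mu.-integrable D (EFin \o (fun x => u x - v x)).
      exact: (integrableB mD ui vi).
    apply: le_integrable (integrableZl mD L uvi) => //.
      apply/measurable_EFinP; apply: measurable_funM; last exact: msc.
      exact: measurable_funB.
    move=> x Dx; rewrite /= lee_fin !normrM mulrC ler_wpM2r//.
    exact: le_trans (LP _) (ler_norm _).
  apply: (@le_trans _ _
    (\int[mu]_(x in D) (t n x + (u x - v x) * s (c n (v x))))%:E).
    by rewrite lee_fin RintegralD// lerDl.
  have tdi : mu.-integrable D
    (fun x => (t n x + (u x - v x) * s (c n (v x)))%:E).
    exact: (integrableD mD (ti n) di).
  rewrite /Rintegral fineK; last exact: integrable_fin_num tdi.
  apply: le_integral_measurable; first exact: measurable_int tdi.
    by apply/measurable_EFinP; exact: measurableT_comp.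
  by move=> x _; rewrite lee_fin mulrC; exact: tangent_ext_le.
have g0 n x : (0 <= (t n x - ell x)%:E)%E.
  by rewrite lee_fin subr_ge0; exact: tangent_ext_ge.
have fat := @fatou _ _ _ mu D mD (fun n x => (t n x - ell x)%:E) _
  (fun n x _ => g0 n x).
have {}fat : (\int[mu]_(x in D) (phi (v x) - ell x)%:E <=
    limn_einf (fun n => \int[mu]_(x in D) (t n x - ell x)%:E))%E.
  apply: le_trans (fat _); last first.
    move=> n; apply/measurable_EFinP; apply: measurable_funB => //.
    by apply/measurable_EFinP; exact: measurable_int elli.
  rewrite le_eqVlt; apply/orP; left; apply/eqP; apply: eq_integral => x _.
  have cv : (fun n => (t n x - ell x)%:E) @ \oo --> (phi (v x) - ell x)%:E.
    apply: cvg_near_cst; near=> n; rewrite /t tangent_ext_id//.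
    by near: n; exact: nbhs_infty_ger.
  rewrite is_cvg_limn_einfE; last by apply/cvg_ex; eexists; exact: cv.
  by rewrite (cvg_lim _ cv).
have gM : (\int[mu]_(x in D) (phi (v x) - ell x)%:E <= M - k%:E)%E.
  apply: le_trans fat _; rewrite limn_einf_lim.
  apply: lime_le; first exact: is_cvg_einfs.
  apply: nearW => n;
    apply: le_trans (_ : _ <= \int[mu]_(x in D) (t n x - ell x)%:E)%E _.
    by apply: ereal_inf_lbound; exists n => /=.
  have -> : (\int[mu]_(x in D) (t n x - ell x)%:E =
     (\int[mu]_(x in D) t n x)%:E - k%:E)%E.
    rewrite -EFinB /k -RintegralB// /Rintegral fineK//.
    exact: (integrable_fin_num mD (integrableB mD (ti n) elli)).
  by rewrite leeB.
(* M = +oo is trivial and M = -oo contradicts the bound at n = 0. For finite M, phi(v) - ell is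
   integrable and [ell] can be added back. *)
move: {tM}(tM 0%N) gM; case: M => [M _ gM|_ _|//]; last by rewrite leey.
have mg : measurable_fun D (fun x => (phi (v x) - ell x)%:E).
  apply/measurable_EFinP; apply: measurable_funB; first exact: measurableT_comp.
  by apply/measurable_EFinP; exact: measurable_int elli.
have gge0 x : 0 <= phi (v x) - ell x.
  by rewrite subr_ge0; have := left_slope_subgradient phi_convex 0 (v x);
    rewrite subr0.
have gi : mu.-integrable D (EFin \o (fun x => phi (v x) - ell x)).
  apply/integrableP; split => //.
  under eq_integral do rewrite /= ger0_norm//.
  by apply: le_lt_trans gM _; rewrite -EFinB ltry.
have -> : (\int[mu]_(x in D) (phi (v x))%:E =
    \int[mu]_(x in D) (phi (v x) - ell x)%:E + k%:E)%E.
  rewrite /k /Rintegral fineK; last exact: integrable_fin_num elli.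
  rewrite -integralD//; apply: eq_integral => x _.
  by rewrite -EFinD subrK.
by rewrite -leeBrDr.
Unshelve. all: by end_near. Qed.

End convex_integral.

(** * From difference quotients of phi to its left derivative *)

Section minimizer.
Context {R : realType} {d : nat} (i0 : 'I_d).
Notation mu := (lebesgue_rV R d).
Variables (a l : 'rV[R]_d) (l_gt0 : forall i, 0 < l 0 i).
Let Omega := hyperrectangle a l.

(** Divided by its Lipschitz constant C, the clamped left chord is an admissible psi. C depends on
    k, but being positive it is removed before k tends to infinity; the limit then relies on the
    bound [L] of the chords, uniform in k. *)
Lemma minimizer_subgradient (f uf p : 'rV[R]_d -> R) (alpha : R) (phi : R -> R)
  (N : R) : 0 < alpha -> L2 Omega f -> ROF_minimizer Omega f alpha uf ->
  subdiff0 Omega p -> convex_function [set: R^o] phi -> 0 <= N ->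
  0 <= \int[mu]_(x in Omega) ((f x - alpha * p x - uf x) *
         left_slope phi (clamp N (uf x))).
Proof.
move=> alpha0 f2 ufm psub cphi N0; have [uf2 _] := ufm; have [p2 _] := psub.
have mO := measurable_hyperrectangle a l.
have Ooo := hyperrectangle_fin a l_gt0.
set F := f \_ Omega; set P := p \_ Omega; set U := uf \_ Omega.
pose D x := F x - alpha * P x - U x.
have Di : mu.-integrable setT (EFin \o D).
  have := L2_integrable mO Ooo (L2D (L2D f2 (L2Z (- alpha) p2)) (L2Z (-1) uf2)).
  apply: eq_integrable => // x _.
  by rewrite /= !restrictD !restrictZ mulN1r mulNr.
have [mU _] := (L2P _ _).1 uf2.
have restrictE (psi : R -> R) x : ((psi \o uf) \_ Omega) x = \1_Omega x * psi
  (U x).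
  by rewrite /U !patchE indicE; case: ifP => _; rewrite ?mul1r ?mul0r.
have [L LP] := left_chord_clamp_bounded cphi N0.
have mphi := continuous_measurable_fun (convex_continuous cphi).
pose r k x := \1_Omega x * left_chord phi k (clamp N (U x)).
have mr k : measurable_fun setT (r k).
  apply: measurable_funM => //.
  apply: (measurableT_comp (measurable_left_chord cphi k)).
  apply: measurableT_comp mU.
  exact: continuous_measurable_fun (@clamp_continuous _ _).
have rL k x : `|r k x| <= L.
  rewrite /r indicE; case: (x \in Omega); rewrite ?mul1r ?mul0r ?normr0//.
  exact: le_trans (LP k 0).
pose q k x := D x * r k x.
have qi k : mu.-integrable setT (EFin \o q k)
  by exact: integrable_bounded_mul (rL k).
have q0 k : 0 <= \int[mu]_x q k x.
  have [C C0 CP] := left_chord_clamp_lipschitz cphi k N0.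
  have := @minimizer_variation _ _ i0 a l l_gt0 f uf p alpha
    (fun x => C^-1 * left_chord phi k (clamp N x)) alpha0 f2 ufm psub.
  have psi1 x y : x <= y -> 0 <= C^-1 * left_chord phi k (clamp N y) -
      C^-1 * left_chord phi k (clamp N x) <= y - x.
    move=> /CP /andP[h1 h2]; rewrite -mulrBr mulr_ge0 ?invr_ge0 ?(ltW C0)//=.
    by rewrite mulrC ler_pdivrMr// mulrC.
  move=> /(_ psi1).
  have -> : \int[mu]_x
    (D x * (((fun x => C^-1 * left_chord phi k (clamp N x)) \o uf)
      \_ Omega) x) = C^-1 * \int[mu]_x q k x.
    rewrite -RintegralZl//.
    by apply: eq_Rintegral => x _; rewrite restrictE /q /r; ring.
  by rewrite pmulr_rge0// invr_gt0.
have [| | | |_ qc] := @cvg_Rintegral _ _ _ mu q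
  (fun x => D x * (\1_Omega x * left_slope phi (clamp N (U x))))
  (fun x => L * `|D x|).
- by move=> k; apply/measurable_EFinP; exact: measurable_int (qi k).
- by move=> x; apply: cvgMr; apply: cvgMr; exact: left_chord_cvg.
- exact/integrable_scale/integrable_normr.
- by move=> k x; rewrite /q normrM mulrC ler_wpM2r.
have -> : \int[mu]_(x in Omega) ((f x - alpha * p x - uf x) *
    left_slope phi (clamp N (uf x))) =
    \int[mu]_x (D x * (\1_Omega x * left_slope phi (clamp N (U x)))).
  rewrite Rintegral_mkcond; apply: eq_Rintegral => x _.
  rewrite /D /F /P /U !patchE indicE; case: ifP => _; rewrite ?mul1r ?mul0r//.
  by rewrite mulr0.
rewrite -(cvg_lim _ qc)//; apply: limr_ge; last exact: nearW.
by apply/cvg_ex; eexists; exact: qc.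
Qed.

End minimizer.

Theorem theorem8p5 (R : realType) (d : nat) (d_ge1 : (1 <= d)%N)
    (a l : 'rV[R]_d) (l_gt0 : forall i, 0 < l 0 i)
    (alpha : R) (alpha_gt0 : 0 < alpha)
    (f : 'rV[R]_d -> R) (f_L2 : L2 (hyperrectangle a l) f)
    (uf : 'rV[R]_d -> R) (uf_min : ROF_minimizer (hyperrectangle a l) f alpha uf)
    (u : 'rV[R]_d -> R)
    (u_dual : [set (fun x => f x - alpha * p x)
              | p in subdiff0 (hyperrectangle a l)] u)
    (phi : R -> R) (phi_convex : convex_function [set: R^o] phi) :
  (\int[lebesgue_rV R d]_(x in hyperrectangle a l) (phi (uf x))%:E
   <= \int[lebesgue_rV R d]_(x in hyperrectangle a l) (phi (u x))%:E)%E.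
Proof.
have i0 : 'I_d := Ordinal d_ge1.
have mO := measurable_hyperrectangle a l.
have Ooo := hyperrectangle_fin a l_gt0.
have [uf2 _] := uf_min; case: u_dual => p psub <-; have [p2 _] := psub.
have integrable_L2 v : L2 (hyperrectangle a l) v ->
    (lebesgue_rV R d).-integrable (hyperrectangle a l) (EFin \o v).
  move=> v2; apply/(integrable_mkcond _ mO).
  by rewrite restrict_EFin; exact: L2_integrable.
apply: convex_integral_le => //.
- apply: integrable_L2.
  rewrite (_ : (fun x => _) = fun x => f x + - alpha * p x);
    first exact/L2D/L2Z.
  by apply/funext => x; rewrite mulNr.
- exact: integrable_L2.
- by move=> n; exact: minimizer_subgradient.
Qed.
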